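(* Let $\mathcal G$ be a metric graph having a finite volume end which is not free. Then there exists a function $f\in\mathrm{dom}(\mathbf H)$ (the domain of the maximal Kirchhoff Laplacian) which does not belong to $H^1(\mathcal G)$.
   Context: Metric graphs. Let $\mathcal G_d=(\mathcal V,\mathcal E)$ be an unoriented graph with countably infinite vertex and edge sets which is locally finite (each vertex $v$ has finite degree), connected and simple (no loops or multiple edges). Given edge lengths $|e|\in(0,\infty)$, $e\in\mathcal E$, the metric graph $\mathcal G=(\mathcal G_d,|\cdot|)$ is the topological space obtained by identifying each edge $e$ with the interval $[0,|e|]$ and gluing together endpoints corresponding to the same vertex. It carries the natural path metric and the Lebesgue measure on its edges, denoted $\mathrm{vol}$. $\mathcal E_v$ is the set of edges incident to $v$; a function $f$ on $\mathcal G$ has edge components $f_e=f|_e$; $f_e'(v)$ denotes the derivative of $f_e$ at the vertex $v$ of $e$ taken in the direction pointing from $v$ into $e$. $L^2(\mathcal G)=\bigoplus_{e}L^2(e)$. Ends. Consider sequences $(U_n)_{n\ge0}$ of non-empty open connected subsets of $\mathcal G$ with compact boundaries, $U_{n+1}\subseteq U_n$ and $\bigcap_n\overline{U_n}=\emptyset$. Two such sequences $(U_n),(U_n')$ are equivalent if for every $n$ there are $j,k$ with $U_n\supseteq U_j'$ and $U_n'\supseteq U_k$. Equivalence classes are called topological ends of $\mathcal G$. A topological end $\gamma$ has finite volume if there is a sequence $(U_n)$ representing $\gamma$ with $\mathrm{vol}(U_n)<\infty$ for some $n$. A ray is a sequence $(v_n)_{n\ge0}$ of distinct vertices with $v_n\sim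 v_{n+1}$ for all $n$; two rays are equivalent if there is a third ray containing infinitely many vertices of both; an equivalence class of rays is a graph end. For each topological end $\gamma$ there is a unique graph end $\omega_\gamma$ such that for every sequence $(U_n)$ representing $\gamma$ each $U_n$ contains a ray from $\omega_\gamma$, and $\gamma\mapsto\omega_\gamma$ is a bijection; topological ends and graph ends are identified in this way. An end $\omega$ is free if there is a finite set $X\subset\mathcal V$ of vertices separating $\omega$ from all other ends, i.e. the rays of all ends $\omega'\ne\omega$ end up in different connected components of $\mathcal V\setminus X$ than the rays of $\omega$. Operators. The maximal Kirchhoff Laplacian $\mathbf H$ in $L^2(\mathcal G)$ acts by $f\mapsto -f''$ edgewise on the domain of all $f\in L^2(\mathcal G)$ with $f_e\in H^2(e)$ for all $e$, $f''\in L^2(\mathcal G)$, and satisfying at every vertex $v$ the Kirchhoff conditions: $f$ is continuous at $v$ and $\sum_{e\in\mathcal E_v}f_e'(v)=0$. $H^1(\mathcal G)$ is the space of continuous $f\in L^2(\mathcal G)$ with $f_e\in H^1(e)$ for all $e$ and $\|f'\|_{L^2(\mathcal G)}^2=\sum_e\|f_e'\|^2_{L^2(e)}<\infty$. *)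

(* Defs.v *)
From HB Require Import structures.
From mathcomp Require Import all_boot all_order all_algebra.
From mathcomp Require Import all_classical all_reals all_analysis.

Set Implicit Arguments.
Unset Strict Implicit.
Unset Printing Implicit Defensive.

Import Order.TTheory GRing.Theory Num.Theory.
Import numFieldNormedType.Exports.

Local Open Scope classical_set_scope.
Local Open Scope ring_scope.

(** * Metric graphs *)

Definition joins (V E : Type) (src tgt : E -> V) (e : E) (u v : V) : Prop :=
  (src e = u /\ tgt e = v) \/ (src e = v /\ tgt e = u).

Definition adjacent (V E : Type) (src tgt : E -> V) : rel V :=
  fun u v => `[< exists e, joins src tgt e u v >].

(** The graph is unoriented: [src e] and [tgt e] are only the vertices placed at
    the end points [0] and [len e] when the edge [e] is identified with the
    interval [0, len e]. *)
Record metric_graph (R : realType) := MetricGraph {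
  vertex : choiceType;
  edge : choiceType;
  src : edge -> vertex;
  tgt : edge -> vertex;
  len : edge -> R;
  len_gt0 : forall e, 0 < len e;
  vertex_countably_infinite : ([set: vertex] #= [set: nat])%card;
  edge_countably_infinite : ([set: edge] #= [set: nat])%card;
  no_loop : forall e, src e <> tgt e;
  no_multiple_edge : forall e e' u v,
    joins src tgt e u v -> joins src tgt e' u v -> e = e';
  locally_finite : forall v, finite_set [set e | src e = v \/ tgt e = v];
  graph_connected : forall u v, exists p : seq vertex,
    path (adjacent src tgt) u p /\ last u p = v
}.

Arguments src {R G} e : rename.
Arguments tgt {R G} e : rename.
Arguments len {R G} e : rename.

Definition adj {R : realType} {G : metric_graph R} : rel (vertex G) :=
  adjacent (@src R G) (@tgt R G).

Definition incident {R : realType} {G : metric_graph R} (v : vertex G) :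
  set (edge G) := [set e | src e = v \/ tgt e = v].

(** The underlying set of the metric graph: the disjoint union of the vertices
    and of the open edges. *)
Inductive carrier (R : realType) (G : metric_graph R) : Type :=
| Vertex of vertex G
| Inner (e : edge G) (t : R) of 0 < t < len e.

Arguments Vertex {R G} v.
Arguments Inner {R G} e t _.

HB.instance Definition _ (R : realType) (G : metric_graph R) :=
  gen_eqMixin (carrier G).
HB.instance Definition _ (R : realType) (G : metric_graph R) :=
  gen_choiceMixin (carrier G).

Section Topology.
Context {R : realType} {G : metric_graph R}.

(** The gluing map [0, len e] -> G; its values outside [0, len e] play no
    role. *)
Definition chart (e : edge G) (t : R) : carrier G :=
  match @idP (0 < t < len e) with
  | ReflectT lt_t => Inner e t lt_t
  | ReflectF _ => if t <= 0 then Vertex (src e) else Vertex (tgt e)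
  end.

(** The quotient topology obtained by gluing the intervals [0, len e]: a set is
    open iff its trace on every closed edge is relatively open. *)
Definition graph_open (U : set (carrier G)) : Prop :=
  forall e, open (chart e @^-1` U : set (subspace `[0, len e])).

Lemma graph_openT : graph_open setT.
Proof. by move=> e; rewrite preimage_setT; exact: openT. Qed.

Lemma graph_openI : setI_closed graph_open.
Proof. by move=> A B oA oB e; rewrite preimage_setI; exact: openI. Qed.

Lemma graph_open_bigU (I : Type) (f : I -> set (carrier G)) :
  (forall i, graph_open (f i)) -> graph_open (\bigcup_i f i).
Proof.
move=> fo e; rewrite preimage_bigcup.
by apply: bigcup_open => i _; exact: fo.
Qed.

HB.instance Definition _ := isOpenTopological.Build (carrier G)
  graph_openT graph_openI graph_open_bigU.

Definition vol (U : set (carrier G)) : \bar R :=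
  \esum_(e in [set: edge G])
    lebesgue_measure (`[0, len e] `&` chart e @^-1` U).

End Topology.

(** * Topological ends and graph ends *)

Section Ends.
Context {R : realType} {G : metric_graph R}.

Definition is_end_seq (U : nat -> set (carrier G)) : Prop :=
  [/\ forall n, [/\ U n !=set0, open (U n), connected (U n) &
        compact (closure (U n) `\` interior (U n))],
      forall n, U n.+1 `<=` U n &
      \bigcap_n closure (U n) = set0].

Definition end_seq_equiv (U U' : nat -> set (carrier G)) : Prop :=
  forall n, (exists j, U' j `<=` U n) /\ (exists k, U k `<=` U' n).

Definition is_topological_end (gamma : set (nat -> set (carrier G))) : Prop :=
  exists2 U, is_end_seq U &
    gamma = [set U' | is_end_seq U' /\ end_seq_equiv U U'].

Definition finite_volume (gamma : set (nat -> set (carrier G))) : Prop :=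
  exists2 U, gamma U & exists n, (vol (U n) < +oo)%E.

Definition is_ray (r : nat -> vertex G) : Prop :=
  injective r /\ forall n, adj (r n) (r n.+1).

Definition ray_equiv (r r' : nat -> vertex G) : Prop :=
  exists s, [/\ is_ray s,
    infinite_set (range s `&` range r) &
    infinite_set (range s `&` range r')].

Definition is_graph_end (omega : set (nat -> vertex G)) : Prop :=
  exists2 r, is_ray r & omega = [set r' | is_ray r' /\ ray_equiv r r'].

(** [omega] is the graph end identified with the topological end [gamma]. *)
Definition corresponds (gamma : set (nat -> set (carrier G)))
    (omega : set (nat -> vertex G)) : Prop :=
  [/\ is_topological_end gamma, is_graph_end omega &
    forall U, gamma U -> forall n,
      exists2 r, omega r & forall k, U n (Vertex (r k))].

(** [u] and [v] lie in the same connected component of the graph with the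
    vertices of [X] removed. *)
Definition same_component_off (X : set (vertex G)) (u v : vertex G) : Prop :=
  exists p : seq (vertex G),
    [/\ path adj u p, last u p = v & forall w, w \in u :: p -> ~ X w].

Definition free_end (omega : set (nat -> vertex G)) : Prop :=
  exists2 X : set (vertex G), finite_set X &
    forall omega', is_graph_end omega' -> omega' <> omega ->
    forall r r', omega r -> omega' r' ->
    exists N, forall n m, (N <= n)%N -> (N <= m)%N ->
      ~ same_component_off X (r n) (r' m).

End Ends.

(** * Function spaces *)

(** Real scalars. Elements of H^1 and of the domain of the Laplacian are
    represented by their (unique) continuous representatives. *)

Section Interval.
Context {R : realType}.

Definition L2_sqnorm (l : R) (u : R -> R) : \bar R :=
  (\int[lebesgue_measure]_(t in `[0%R, l]) ((u t) ^+ 2)%:E)%E.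

Definition L2_interval (l : R) (u : R -> R) : Prop :=
  measurable_fun (`[0, l] : set R) u /\ (L2_sqnorm l u < +oo)%E.

(** [u] belongs to H^1(0, l), with derivative [u'] in L^2(0, l).  In dimension
    one, H^1(0, l) consists of the functions absolutely continuous on [0, l],
    i.e. the primitives of integrable functions, whose derivative is square
    integrable. *)
Definition H1_deriv (l : R) (u u' : R -> R) : Prop :=
  L2_interval l u' /\
  forall t, t \in `[0, l] ->
    u t = u 0 + \int[lebesgue_measure]_(s in `[0, t]) u' s.

End Interval.

Section Laplacian.
Context {R : realType} {G : metric_graph R}.

Definition component (f : carrier G -> R) (e : edge G) : R -> R :=
  fun t => f (chart e t).

(** L^2(G) as the Hilbert sum of the spaces L^2(e). *)
Definition L2_graph (u : edge G -> R -> R) : Prop :=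
  (forall e, L2_interval (len e) (u e)) /\
  (\esum_(e in [set: edge G]) L2_sqnorm (len e) (u e) < +oo)%E.

Definition H1_graph (f : carrier G -> R) : Prop :=
  [/\ continuous f, L2_graph (component f) &
    exists f' : edge G -> R -> R,
      (forall e, H1_deriv (len e) (component f e) (f' e)) /\ L2_graph f'].

(** The derivative of [f] along [e] at the end point [v] of [e], in the
    direction pointing from [v] into [e]. *)
Definition outward_deriv (f : carrier G -> R) (v : vertex G) (e : edge G) : R :=
  if v == src e
  then lim ((f (chart e h) - f (chart e 0)) / h @[h --> 0^'+])
  else lim ((f (chart e (len e - h)) - f (chart e (len e))) / h @[h --> 0^'+]).

Definition kirchhoff (f : carrier G -> R) (v : vertex G) : Prop :=
  {for Vertex v, continuous f} /\
  \sum_(e \in incident v) outward_deriv f v e = 0.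

(** The domain of the maximal Kirchhoff Laplacian. *)
Definition dom_H (f : carrier G -> R) : Prop :=
  [/\ L2_graph (component f),
    exists f' f'' : edge G -> R -> R,
      (forall e, H1_deriv (len e) (component f e) (f' e) /\
                 H1_deriv (len e) (f' e) (f'' e)) /\
      L2_graph f'' &
    forall v, kirchhoff f v].

End Laplacian.

(* Main.v *)
(** A finite set X of vertices cuts off a component D, of finite total length,
    that contains the end.  Piecewise linear functions that vanish outside D and
    are harmonic at the vertices of D are square integrable as soon as they are
    bounded, and become elements of the domain after a correction by cubics on
    the finitely many edges at X.

    Since the end is not free, D contains, outside any finite set Z, paths
    between a ray of this end and a ray of another end.  A finite vertex set
    separating these two rays provides, by minimizing the Dirichlet energy, a
    harmonic function with values in [0, 1] tending to 1 along the first ray and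
    to 0 along the second one (finite length makes the boundary values survive
    the limit).  Such a function changes by 1/2 along a path of arbitrarily small
    length, hence its energy is large.  A gliding hump turns these functions into
    a single bounded harmonic function of infinite energy, whose increments along
    the edges rule out a square integrable derivative. *)
Require Import Defs.
From mathcomp Require Import all_boot all_order all_algebra.
From mathcomp Require Import all_classical all_reals all_analysis.
From mathcomp Require Import finmap measurable_realfun ring lra zify.

Set Implicit Arguments.
Unset Strict Implicit.
Unset Printing Implicit Defensive.

Import Order.TTheory GRing.Theory Num.Theory.
Import numFieldNormedType.Exports.

Local Open Scope classical_set_scope.
Local Open Scope ring_scope.

(** * Rays and ends *)

Lemma finite_nat_bounded (A : set nat) :
  finite_set A -> exists N, forall n, (N <= n)%N -> ~ A n.
Proof.
case/finite_seqP => s ->; exists (\max_(i <- s) i).+1 => n ltn /= ns.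
by move: ltn; rewrite ltnNge leq_bigmax_seq.
Qed.

Section Rays.
Context {R : realType} {G : metric_graph R}.
Implicit Types (X Y : set (vertex G)) (u v w : vertex G) (r s : nat -> vertex G).

Lemma adj_sym : symmetric (@adj R G).
Proof.
by move=> u v; apply/asboolP/asboolP => -[e [[? ?]|[? ?]]]; exists e;
  [right|left|right|left].
Qed.

Lemma same_component_off_refl X u : ~ X u -> same_component_off X u u.
Proof. by move=> Xu; exists [::]; split=> // w; rewrite inE => /eqP->. Qed.

Lemma same_component_off_trans X v u w : same_component_off X u v ->
  same_component_off X v w -> same_component_off X u w.
Proof.
move=> [p [pu <- pX]] [q [qv <- qX]]; exists (p ++ q).
rewrite cat_path pu qv last_cat; split=> // z.
rewrite -cat_cons mem_cat => /orP[/pX//|zq]; apply: qX.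
by rewrite inE zq orbT.
Qed.

Lemma same_component_off_sym X u v :
  same_component_off X u v -> same_component_off X v u.
Proof.
move=> [p [pu <- pX]]; exists (rev (belast u p)); split.
- by rewrite rev_path (eq_path (e' := adj))// => x y; rewrite adj_sym.
- by case: p {pu pX} => //= x p; rewrite rev_cons last_rcons.
- by move=> w; rewrite -rev_rcons -lastI mem_rev; exact: pX.
Qed.

Lemma same_component_off_sub X Y u v : X `<=` Y ->
  same_component_off Y u v -> same_component_off X u v.
Proof. by move=> XY [p [pu pv pY]]; exists p; split=> // w /pY wY /XY. Qed.

Lemma same_component_off_adj X u v : ~ X u -> ~ X v -> adj u v ->
  same_component_off X u v.
Proof.
move=> Xu Xv uv; exists [:: v]; split=> //=; first by rewrite uv.
by move=> w; rewrite !inE => /orP[]/eqP->.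
Qed.

Lemma same_component_offr X u v : same_component_off X u v -> ~ X v.
Proof. by move=> [p [_ <- pX]]; apply: pX; exact: mem_last. Qed.

Lemma ray_eventually_off r X : is_ray r -> finite_set X ->
  exists N, forall n, (N <= n)%N -> ~ X (r n).
Proof.
move=> [rI _] Xf; suff : finite_set (r @^-1` X) by exact: finite_nat_bounded.
by apply: finite_preimage => // x y _ _; exact: rI.
Qed.

Lemma ray_tail_connected r X N : is_ray r ->
  (forall n, (N <= n)%N -> ~ X (r n)) ->
  forall n m, (N <= n)%N -> (N <= m)%N -> same_component_off X (r n) (r m).
Proof.
move=> [_ radj] rX n m.
wlog nm : n m / (n <= m)%N.
  move=> H Nn Nm; case/orP: (leq_total n m) => ?; first exact: H.
  by apply: same_component_off_sym; exact: H.
rewrite -(subnK nm) => Nn _; elim: (m - n)%N => [|k IH].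
  by apply: same_component_off_refl; exact: rX.
apply: (same_component_off_trans IH); apply: same_component_off_adj.
- by apply: rX; lia.
- by apply: rX; lia.
- by rewrite addSn.
Qed.

Lemma ray_meets_finite (s : nat -> vertex G) (A : set (vertex G)) : is_ray s ->
  (forall N, exists2 n, (N <= n)%N & A (s n)) -> infinite_set (range s `&` A).
Proof.
move=> sr sA fin; have [N sN] := ray_eventually_off sr fin.
have [n Nn An] := sA N; apply: (sN n) => //; split=> //; by exists n.
Qed.

Lemma infinite_ray_inter s r N : is_ray s -> is_ray r ->
  infinite_set (range s `&` range r) ->
  exists k n, [/\ (N <= k)%N, (N <= n)%N & s k = r n].
Proof.
move=> sr rr; apply: contra_notP => H.
apply: (@sub_finite_set _ _ ([set s k | k in `I_N] `|` [set r k | k in `I_N])).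
  move=> _ [[k _ <-] [n _ rn]]; case: (ltnP k N) => kN; first by left; exists k.
  case: (ltnP n N) => nN; first by right; exists n.
  by exfalso; apply: H; exists k, n.
by rewrite finite_setU; split; apply: finite_image; exact: finite_II.
Qed.

(** Separation form of ray equivalence, shown below to agree with [ray_equiv] on rays; its
    transitivity is a concatenation of paths. The index [N] makes it a property of tails. *)
Definition inseparable r r' := forall Y, finite_set Y ->
  forall N, exists n m, [/\ (N <= n)%N, (N <= m)%N &
    same_component_off Y (r n) (r' m)].

Lemma inseparable_sym r r' : inseparable r r' -> inseparable r' r.
Proof.
move=> H Y Yf N; have [n [m [Nn Nm c]]] := H Y Yf N.
by exists m, n; split=> //; exact: same_component_off_sym.
Qed.

Lemma inseparable_trans r' r r'' : is_ray r' ->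
  inseparable r r' -> inseparable r' r'' -> inseparable r r''.
Proof.
move=> rr' H H' Y Yf N; have [M rM] := ray_eventually_off rr' Yf.
have [n [m [Nn Nm c]]] := H Y Yf (maxn N M).
have [n' [m' [Nn' Nm' c']]] := H' Y Yf (maxn N M).
exists n, m'; split; [lia|lia|].
apply: (same_component_off_trans c); apply: (same_component_off_trans _ c').
by apply: (ray_tail_connected rr' rM); lia.
Qed.

(** Each ray meets the common ray [s] at vertices of large index in both, where the connecting path
    is trivial; transitivity through [s] does the rest. *)
Lemma ray_equiv_inseparable r r' : is_ray r -> is_ray r' ->
  ray_equiv r r' -> inseparable r r'.
Proof.
have sub s t : is_ray s -> is_ray t -> infinite_set (range s `&` range t) ->
    inseparable s t.
  move=> sr tr st Y Yf N; have [M sM] := ray_eventually_off sr Yf.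
  have [k [n [Nk Nn kn]]] := infinite_ray_inter (maxn N M) sr tr st.
  exists k, n; split; [lia|lia|]; rewrite -kn.
  by apply: same_component_off_refl; apply: sM; lia.
move=> rr rr' [s [sr ssr ssr']].
by apply: (inseparable_trans sr); [apply: inseparable_sym; exact: sub|exact: sub].
Qed.

(** Invariant of the construction of a common ray: the path has reached [r] and can follow it from
    there on without revisiting a vertex. *)
Definition ready r x p := exists2 b, last x p = r b &
  forall j, (b < j)%N -> r j \notin x :: p.

(* The path follows [r] up to a connecting path from [r] to [r'] that avoids
   all the vertices met so far. *)
Lemma extend_to_ray r r' x p : is_ray r -> is_ray r' -> inseparable r r' ->
  finite_set (range r `&` range r') ->
  path adj x p -> uniq (x :: p) -> ready r x p ->
  exists2 q, q != [::] &
    [/\ path adj x (p ++ q), uniq (x :: p ++ q) & ready r' x (p ++ q)].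
Proof.
move=> rr rr' insep fin px pu [b pb bp].
have fx : finite_set ([set` x :: p] `|` (range r `&` range r')).
  by rewrite finite_setU; split.
have [M1 rM1] := ray_eventually_off rr fx.
have [M2 rM2] := ray_eventually_off rr' fx.
(* From index [M] on, each ray avoids both the path so far and the other ray. *)
pose M := maxn b (maxn M1 M2).
have rM j : (M <= j)%N -> r j \notin x :: p /\ ~ range r' (r j).
  move=> Mj.
  have /not_orP[/negP ? nr] : ~ ([set` x :: p] `|` (range r `&` range r')) (r j).
    by apply: rM1; lia.
  by split=> // ?; apply: nr; split=> //; exists j.
have r'M j : (M <= j)%N -> r' j \notin x :: p /\ ~ range r (r' j).
  move=> Mj.
  have /not_orP[/negP ? nr] : ~ ([set` x :: p] `|` (range r `&` range r')) (r' j).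
    by apply: rM2; lia.
  by split=> // ?; apply: nr; split=> //; exists j.
(* Removing the initial segments forces every vertex of a connecting path that lies on one of the
   rays to have index above [M]. *)
pose Y := [set` x :: p] `|` ([set r j | j in `I_M.+1] `|` [set r' j | j in `I_M.+1]).
have Yf : finite_set Y.
  by rewrite !finite_setU; split=> //; split; apply: finite_image; exact: finite_II.
have [n0 [m0 [Mn0 Mm0 [Q [Qp Ql QY]]]]] := insep Y Yf M.+1.
have Yr z j : ~ Y z -> z = r j -> (M < j)%N.
  move=> Yz zj; rewrite ltnNge; apply/negP => jM; apply: Yz; right; left.
  by exists j.
have Yr' z j : ~ Y z -> z = r' j -> (M < j)%N.
  move=> Yz zj; rewrite ltnNge; apply/negP => jM; apply: Yz; right; right.
  by exists j.
(* shorten to a path leaving [r] at its first vertex and meeting [r'] only at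
   its last *)
have [z0 [q [qp qu qY [[n zn] [m qm]] qr]]] : exists z0 q,
  [/\ path adj z0 q, uniq (z0 :: q), forall w, w \in z0 :: q -> ~ Y w,
      (exists n, z0 = r n) /\ (exists m, last z0 q = r' m) &
      forall w, w \in q -> ~ range r w /\ (range r' w -> w = last z0 q)].
  have : exists k z0 q, [/\ size q = k, path adj z0 q,
     forall w, w \in z0 :: q -> ~ Y w, (exists n, z0 = r n) &
     (exists m, last z0 q = r' m)].
    exists (size Q), (r n0), Q; split=> //; first by exists n0.
    by exists m0.
  pose P k := `[< exists z0 q, [/\ size q = k, path adj z0 q,
     forall w, w \in z0 :: q -> ~ Y w, (exists n, z0 = r n) &
     (exists m, last z0 q = r' m)] >].
  move=> H; have exP : exists k, P k by case: H => k ?; exists k; apply/asboolP.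
  case: (ex_minnP exP) => k /asboolP[z0 [q [sq qp qY qn qm]]] kmin.
  move: kmin; rewrite -{k}sq => kmin.
  have {qp kmin qY qm} [q' [qp qu qY qm kmin]] : exists q', [/\ path adj z0 q',
      uniq (z0 :: q'), forall w, w \in z0 :: q' -> ~ Y w,
      (exists m, last z0 q' = r' m) & forall z1 q1, path adj z1 q1 ->
        (forall w, w \in z1 :: q1 -> ~ Y w) -> (exists n, z1 = r n) ->
        (exists m, last z1 q1 = r' m) -> (size q' <= size q1)%N].
    case/shortenP: qp qm => q' q'p q'u q'q qm; exists q'; split=> //.
      by move=> w; rewrite inE => /predU1P[->|/q'q wq];
        apply: qY; rewrite inE ?eqxx ?wq ?orbT.
    move=> z1 q1 *; apply: (@leq_trans (size q)).
      by apply: uniq_leq_size => //; case/andP: q'u.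
    by apply: kmin; apply/asboolP; exists z1, q1.
  (* By minimality: a later vertex on [r] would start a shorter path, and an earlier vertex on [r']
     would end one. *)
  exists z0, q'; split=> // w wq.
  case/splitPr: wq qp qu qY qm kmin => q1 q2.
  rewrite cat_path last_cat => /= /and3P[q1p q1w q2p] qu qY qm kmin; split.
    move=> [j _ rj]; have := kmin w q2 q2p; rewrite size_cat /=.
    have Hv : forall v, v \in w :: q2 -> ~ Y v.
      by move=> v vq; apply: qY; rewrite inE mem_cat vq !orbT.
    by move=> /(_ Hv (ex_intro _ j (esym rj)) qm); lia.
  move=> [j _ rj]; case: q2 q2p qu qY qm kmin => //= y q2 q2p qu qY qm kmin.
  have := kmin z0 (rcons q1 w); rewrite rcons_path q1p q1w last_rcons => /(_ isT).
  have Hv : forall v, v \in z0 :: rcons q1 w -> ~ Y v.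
    move=> v; rewrite inE mem_rcons => /predU1P[->|vq]; apply: qY.
      by rewrite inE eqxx.
    by move: vq; rewrite !inE mem_cat !inE => /orP[->|->]; rewrite !orbT.
  by move=> /(_ Hv qn (ex_intro _ j (esym rj))); rewrite size_rcons size_cat /=; lia.
have bn : (b < n)%N.
  by have := Yr z0 n (qY _ (mem_head _ _)) zn; lia.
have radj := rr.2; have rI := rr.1.
(* The indices run over [b + 1, ..., n]: [r b] already ends the path, and [r n] is [z0]. *)
pose c := [seq r i | i <- iota b.+1 (n - b)].
have cp k : path adj (r b) [seq r i | i <- iota b.+1 k] /\
    last (r b) [seq r i | i <- iota b.+1 k] = r (b + k)%N.
  elim: k => [|k [IHp IHl]]; first by rewrite addn0.
  rewrite -[k.+1]addn1 iotaD map_cat cat_path last_cat IHp IHl /= addSn radj.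
  by split=> //; congr r; lia.
have [cpath clast] : path adj (r b) c /\ last (r b) c = z0.
  by have [? ->] := cp (n - b)%N; rewrite zn subnKC// ltnW.
have cmem w : w \in c -> exists2 j, (b < j)%N & w = r j.
  by case/mapP=> j; rewrite mem_iota => jb ->; exists j => //; lia.
exists (c ++ q).
  by rewrite /c; have -> : (n - b)%N = (n - b).-1.+1 by lia.
have xc : last x (p ++ c) = z0 by rewrite last_cat pb.
split.
- by rewrite catA cat_path xc cat_path px pb cpath.
- rewrite -cat_cons cat_uniq pu /=; apply/andP; split.
    apply/hasPn => w; rewrite mem_cat => /orP[/cmem[j bj ->]|wq]; first exact: bp.
    apply/negP => wp; apply: (qY w); first by rewrite inE wq orbT.
    by left.
  have quq : uniq q by case/andP: qu.
  rewrite cat_uniq quq andbT.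
  rewrite map_inj_uniq// iota_uniq; apply/hasPn => w /qr[nr _].
  by apply/negP => /cmem[j _ wj]; apply: nr; exists j.
- exists m; first by rewrite catA last_cat xc.
  have mM : (M < m)%N.
    by apply: (Yr' _ _ _ qm); apply: qY; exact: mem_last.
  move=> j mj; have [nxp nr] := r'M j ltac:(lia).
  rewrite -cat_cons mem_cat negb_or; apply/andP; split=> //.
  rewrite mem_cat negb_or; apply/andP; split.
    by apply/negP => /cmem[i _ ij]; apply: nr; exists i.
  apply/negP => /qr[_ /(_ (ex_intro2 _ _ j I erefl))]; rewrite qm => /rr'.1.
  by lia.
Qed.

(** If the rays meet infinitely often, [r] itself is a common ray. Otherwise a finite simple path is
    extended alternately to [r'] and to [r]; the union of these paths is a ray meeting both
    infinitely often. *)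
Lemma inseparable_ray_equiv r r' : is_ray r -> is_ray r' ->
  inseparable r r' -> ray_equiv r r'.
Proof.
move=> rr rr' insep.
have [inf|/contrapT fin] := pselect (infinite_set (range r `&` range r')).
  by exists r; split=> //; rewrite setIid; apply: sub_infinite_set inf => ? [].
(* [ro n] is the ray on which the [n]-th path ends. *)
pose ro n := if odd n then r' else r; pose x := r 0%N.
pose good n p := [/\ path adj x p, uniq (x :: p) & ready (ro n) x p].
have step n p : exists q, good n p -> q != [::] /\ good n.+1 (p ++ q).
  have [[pp pu pr]|] := pselect (good n p); last by exists [::].
  suff [q qn [? ? ?]] : exists2 q, q != [::] & [/\ path adj x (p ++ q),
      uniq (x :: p ++ q) & ready (ro n.+1) x (p ++ q)] by exists q.
  move: pr; rewrite /ro /=; case: (odd n) => /= pr.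
    apply: (extend_to_ray rr' rr) => //; first exact: inseparable_sym.
    by rewrite setIC.
  exact: (extend_to_ray rr rr').
pose ext n p := projT1 (cid (step n p)).
have extP n p : good n p -> ext n p != [::] /\ good n.+1 (p ++ ext n p).
  by move=> gp; rewrite /ext; case: cid => q /= /(_ gp).
pose pn := fix pn n := if n is k.+1 then pn k ++ ext k (pn k) else [::].
have pnS n : pn n.+1 = pn n ++ ext n (pn n) by [].
have pgood n : good n (pn n).
  elim: n => [|n /extP[]//]; split=> //; exists 0%N => //= j j0.
  by rewrite inE; apply/eqP => /rr.1; lia.
have psize n : (n <= size (pn n))%N.
  elim: n => // n IH; rewrite pnS size_cat.
  by have [] := extP _ _ (pgood n); case: (ext _ _) => //= *; lia.
have ppre n k : exists q, pn (n + k)%N = pn n ++ q.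
  elim: k => [|k [q IH]]; first by exists [::]; rewrite addn0 cats0.
  by rewrite addnS pnS IH; eexists; rewrite -catA.
(* The [n]-th path has at least [n] edges and is a prefix of all later ones, so its [k]-th vertex no
   longer changes once [k <= n]. *)
pose s k := nth x (x :: pn k) k.
have sE k n : (k <= size (pn n))%N -> s k = nth x (x :: pn n) k.
  have aux i j : (i <= j)%N -> (k <= size (pn i))%N ->
      nth x (x :: pn i) k = nth x (x :: pn j) k.
    move=> ij ki; have [q] := ppre i (j - i)%N; rewrite subnKC// => ->.
    by rewrite -cat_cons nth_cat /= ltnS ki.
  by move=> kn; case/orP: (leq_total k n) => ?; [|apply/esym]; apply: aux.
have slast n : s (size (pn n)) = last x (pn n).
  by rewrite (sE _ n)// -nth_last /=; case: (pn n).
have sr : is_ray s; first split.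
- move=> i j; have [_ pu _] := pgood (maxn i j).
  have := psize (maxn i j) => mn.
  rewrite !(sE _ (maxn i j)); [|lia|lia] => /eqP.
  by rewrite nth_uniq//= ?ltnS; [move/eqP|lia|lia].
- move=> k; have [pp _ _] := pgood k.+1; have := psize k.+1 => mn.
  rewrite !(sE _ k.+1); [|lia|lia] => /=.
  by move/pathP: pp => /(_ x k); apply.
exists s; split=> //; apply: ray_meets_finite => // N.
- exists (size (pn (N.*2))); first by have := psize N.*2; lia.
  have [_ _ [b + _]] := pgood N.*2; rewrite slast => ->.
  by rewrite /ro odd_double; exists b.
- exists (size (pn (N.*2.+1))); first by have := psize N.*2.+1; lia.
  have [_ _ [b + _]] := pgood N.*2.+1; rewrite slast => ->.
  by rewrite /ro /= odd_double; exists b.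
Qed.

Lemma distinct_ends_separable omega omega' r r' :
  is_graph_end omega -> is_graph_end omega' -> omega <> omega' ->
  omega r -> omega' r' ->
  exists2 Y, finite_set Y & exists N, forall n m, (N <= n)%N -> (N <= m)%N ->
    ~ same_component_off Y (r n) (r' m).
Proof.
move=> [r0 rr0 ->] [r1 rr1 ->] ne [rr rr0r] [rr' rr1r].
have [insep|] := pselect (inseparable r r').
  exfalso; apply: ne; apply/seteqP.
  have i0 := ray_equiv_inseparable rr0 rr rr0r.
  have i1 := ray_equiv_inseparable rr1 rr' rr1r.
  have i01 : inseparable r0 r1.
    apply: (inseparable_trans rr i0); apply: (inseparable_trans rr' insep).
    exact: inseparable_sym.
  split=> t [rt t0]; split=> //; apply: inseparable_ray_equiv => //.
    apply: (inseparable_trans rr0 (inseparable_sym i01)).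
    exact: ray_equiv_inseparable.
  by apply: (inseparable_trans rr1 i01); exact: ray_equiv_inseparable.
move/existsNP => [Y /not_implyP[Yf /existsNP[N H]]]; exists Y => //; exists N.
by move=> n m Nn Nm c; apply: H; exists n, m.
Qed.
End Rays.

(** * Discrete harmonic functions *)

(** Limits along an ultrafilter finer than [\oo] exist at all points simultaneously by compactness
    of [[- M, M]]; no diagonal subsequence has to be extracted. *)
Lemma bounded_pointwise_limit (R : realType) (T : Type) (x : nat -> T -> R) (M : R) :
  (forall n t, `|x n t| <= M) ->
  exists2 FF : set_system nat, ProperFilter FF /\ \oo `<=` FF &
  exists y : T -> R, forall t, x n t @[n --> FF] --> y t.
Proof.
move=> xM; have [FF [FU oFF]] := @ultraFilterLemma nat \oo _.
exists FF; first by split=> //; exact: ultra_proper.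
have FP : ProperFilter FF by exact: ultra_proper.
suff H : forall t, exists y : R, x n t @[n --> FF] --> y.
  by have [y yP] := choice H; exists y.
move=> t.
have FM : ((fun n => x n t) @ FF) `[- M, M]%classic.
  by apply: (@filterE _ FF) => n /=; rewrite in_itv /= -ler_norml.
have [p [_ clp]] := @segment_compact R (- M) M _ (fmap_proper_filter _ FP) FM.
exists p => A pA.
have [//|FnA] := in_ultra_setVsetC ((fun n => x n t) @^-1` A) FU.
by have [z [/= nAz Az]] := clp (~` A) A FnA pA.
Qed.

(** * Dirichlet energy, averaging and energy minimizers *)

Section Energy.
Context {R : realType} {G : metric_graph R}.
Implicit Types (D A : set (vertex G)) (u w : vertex G -> R) (v : vertex G).
Implicit Types (e : edge G) (F : {fset edge G}).

(** Dirichlet integral, over the edges in [F], of the edgewise linear function with vertex values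
    [u]. The total energy may be infinite, hence the restriction to finite [F]. *)
Definition energy F u := \sum_(e <- F) (u (tgt e) - u (src e)) ^+ 2 / len e.

Definition other e v := if v == src e then tgt e else src e.

Definition incident_fset v : {fset edge G} := fset_set (incident v).

Lemma in_incident_fset e v : (e \in incident_fset v) = (src e == v) || (tgt e == v).
Proof.
rewrite in_fset_set; last exact: locally_finite.
apply/idP/orP => [/set_mem[->|->]|]; rewrite ?eqxx; [by left|by right|].
by case=> /eqP ev; apply/mem_set; [left|right].
Qed.

(** Minus the sum of the outward slopes at [v] of the edgewise linear interpolation of [u]: it
    vanishes exactly when the interpolation satisfies the Kirchhoff sum condition at [v]. *)
Definition laplacian u v :=
  \sum_(e <- incident_fset v) (u v - u (other e v)) / len e.

Definition conductance v : R := \sum_(e <- incident_fset v) (len e)^-1.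

Lemma len_ge0 e : 0 <= len e.
Proof. by rewrite ltW ?len_gt0. Qed.

Lemma energy_term_ge0 u e : 0 <= (u (tgt e) - u (src e)) ^+ 2 / len e.
Proof. by rewrite divr_ge0 ?sqr_ge0 ?len_ge0. Qed.

Lemma energy_ge0 F u : 0 <= energy F u.
Proof. by apply: sumr_ge0 => e _; exact: energy_term_ge0. Qed.

Lemma energy_mono F F' u : (F `<=` F')%fset -> energy F u <= energy F' u.
Proof.
move=> FF'; rewrite /energy.
have -> : \sum_(e <- F) (u (tgt e) - u (src e)) ^+ 2 / len e =
    \sum_(e <- F') if e \in F then (u (tgt e) - u (src e)) ^+ 2 / len e else 0.
  rewrite -(big_fset_incl _ FF') => [|e _ /negbTE->//].
  by apply: eq_big_seq => e ->.
by apply: ler_sum => e _; case: ifP => // _; exact: energy_term_ge0.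
Qed.

Lemma conductance_ge0 v : 0 <= conductance v.
Proof. by apply: sumr_ge0 => e _; rewrite invr_ge0 len_ge0. Qed.

Definition average u v :=
  (\sum_(e <- incident_fset v) u (other e v) / len e) / conductance v.

Definition averaged u v := fun x => if x == v then average u v else u x.

Lemma laplacian_average u v : 0 < conductance v ->
  laplacian u v = conductance v * (u v - average u v).
Proof.
move=> c0; rewrite /laplacian /average mulrBr mulrCA divff ?gt_eqF// mulr1.
rewrite /conductance mulr_suml -sumrB; apply: eq_bigr => e _; ring.
Qed.

(** As a function of the value at [v], the energy is a quadratic polynomial with leading coefficient
    [conductance v], minimal at the average. *)
Lemma energy_averaged F u v : (incident_fset v `<=` F)%fset ->
  0 < conductance v ->
  energy F (averaged u v) = energy F u - laplacian u v ^+ 2 / conductance v.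
Proof.
move=> vF c0; pose a := average u v.
have aE : a * conductance v = \sum_(e <- incident_fset v) u (other e v) / len e.
  by rewrite /a /average mulfVK ?gt_eqF.
apply: (canRL (subKr _)); rewrite /energy -sumrB -(big_fset_incl _ vF).
  transitivity (\sum_(e <- incident_fset v)
      (u v - a) * ((u v + a) * (len e)^-1 - 2 * (u (other e v) / len e))).
    apply: eq_big_seq => e; rewrite in_incident_fset /averaged /other -/a.
    have nl := @no_loop _ G e; have [<-|ne] /= := eqVneq (src e) v.
      by move=> _; rewrite eq_sym (introF eqP nl); ring.
    by move=> /eqP te; rewrite te eqxx; ring.
  rewrite -mulr_sumr sumrB -!mulr_sumr -aE -/(conductance v).
  by rewrite laplacian_average// -/a; field; rewrite gt_eqF.
move=> e _; rewrite in_incident_fset negb_or /averaged => /andP[/negbTE-> /negbTE->].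
by rewrite subrr.
Qed.

Lemma average_bounded u v a b : 0 < conductance v ->
  (forall x, a <= u x <= b) -> a <= average u v <= b.
Proof.
move=> c0 uab; rewrite /average ler_pdivlMr// ler_pdivrMr//.
by rewrite /conductance !mulr_sumr; apply/andP; split; apply: ler_sum => e _;
  rewrite ler_wpM2r ?invr_ge0 ?len_ge0//; case/andP: (uab (other e v)).
Qed.

(** Each increment [d] over an edge of length [l] satisfies [d <= (t * l + d ^+ 2 / l / t) / 2];
    these bounds are summed over the distinct edges of a simple path. The parameter [t] replaces the
    square root of the Cauchy-Schwarz inequality. *)
Lemma path_oscillation u (B t eps : R) x p : 0 < t -> (forall F, energy F u <= B) ->
  path adj x p -> uniq (x :: p) ->
  (forall F, {in F, forall e, src e \in x :: p /\ tgt e \in x :: p} ->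
    \sum_(e <- F) len e <= eps) ->
  `|u (last x p) - u x| <= (t * eps + B / t) / 2.
Proof.
move=> t0 uB xp xpu Heps.
have {xp xpu} [F Fxp Fu] : exists2 F : {fset edge G},
    {in F, forall e, src e \in x :: p /\ tgt e \in x :: p} &
    `|u (last x p) - u x| <= \sum_(e <- F) `|u (tgt e) - u (src e)|.
  elim: p x xp xpu {Heps} => [|y p IH] x /=.
    by move=> _ _; exists fset0 => //; rewrite subrr normr0 big_seq_fset0.
  move=> /andP[/asboolP[e exy] yp] /andP[xyp ypu].
  have [F FP FE] := IH y yp ypu; exists (e |` F)%fset.
    move=> e'; rewrite !inE => /predU1P[->|/FP[]]; last first.
      by rewrite !inE => -> ->; rewrite !orbT.
    by case: exy => -[-> ->]; rewrite !eqxx !orbT.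
  (* The new edge contains [x], which lies on none of the later edges because the path is simple. *)
  have eF : e \notin F.
    apply/negP => /FP[]; case: exy => -[-> ->] => [H _|_ H];
      by rewrite H in xyp.
  rewrite big_fsetU1//=; apply: le_trans (lerD (lexx _) FE).
  have -> : `|u (tgt e) - u (src e)| = `|u y - u x|.
    by case: exy => -[-> ->] //; rewrite distrC.
  by rewrite [leRHS]addrC ler_distD.
apply: (le_trans Fu).
apply: (@le_trans _ _ (\sum_(e <- F)
    (t * len e + (u (tgt e) - u (src e)) ^+ 2 / len e / t) / 2)).
  apply: ler_sum => e _; have l0 := len_gt0 e.
  rewrite -subr_ge0 -[_ ^+ 2]real_normK ?num_real//; set d := `|_|.
  have -> : (t * len e + d ^+ 2 / len e / t) / 2 - d =
    (t * len e - d) ^+ 2 / (2 * len e * t) by field; rewrite !gt_eqF.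
  by rewrite divr_ge0 ?sqr_ge0// !mulr_ge0// ltW.
rewrite -mulr_suml big_split /= -mulr_sumr -mulr_suml ler_pM2r ?invr_gt0//.
apply: lerD; first by rewrite ler_pM2l// Heps.
by rewrite ler_pM2r ?invr_gt0//; exact: uB.
Qed.

(** Competitors for the minimization. Agreement with the indicator of [A] up to finitely many
    vertices encodes the boundary values at the ends: 1 along rays in [A], 0 along rays that leave
    [A] for good. *)
Definition admissible D A w := [/\ forall v, 0 <= w v <= 1,
  forall v, ~ D v -> w v = 0 & finite_set [set v | w v <> \1_A v]].

Definition harmonic_ball D u := [/\ forall v, `|u v| <= 1,
  forall v, ~ D v -> u v = 0 & forall v, D v -> laplacian u v = 0].

Lemma laplacian_cvg (FF : set_system nat) (w : nat -> vertex G -> R) u v :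
  ProperFilter FF -> (forall x, w n x @[n --> FF] --> u x) ->
  laplacian (w n) v @[n --> FF] --> laplacian u v.
Proof.
move=> FP wu; apply: cvg_big => //; first exact: add_continuous.
by move=> e _; apply: cvgMl; apply: cvgB.
Qed.

(* The minimizing sequence of the energy almost satisfies the mean value
   property, because averaging at a vertex lowers the energy by
   [laplacian ^+ 2 / conductance]. *)
Lemma exists_equilibrium D A : A `<=` D ->
  finite_set [set e | A (src e) <> A (tgt e)] ->
  exists2 u, harmonic_ball D u & exists2 B, 0 < B &
    forall v c d, (forall w, admissible D A w -> (forall F, energy F w <= B) ->
      `|w v - c| <= d) -> `|u v - c| <= d.
Proof.
move=> AD Afin.
pose S := [set B : R | exists2 w, admissible D A w & forall F, energy F w <= B].
(* The indicator of [A] is admissible, and only the finitely many edges leaving [A] contribute to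
   its energy. *)
have Sne : S !=set0.
  exists (energy (fset_set [set e | A (src e) <> A (tgt e)]) \1_A), \1_A.
    split=> [v|v Dv|].
    - by rewrite indicE; case: (v \in A); rewrite ?lexx ler01.
    - by rewrite indicE memNset// => /AD.
    - by rewrite (_ : mkset _ = set0)//; apply/seteqP; split=> // v; exact.
  move=> F; rewrite /energy; set T := fset_set _.
  have [F1 F1T F1E] : exists2 F1, (F1 `<=` T)%fset & energy F \1_A = energy F1 \1_A.
    exists (F `&` T)%fset; first exact: fsubsetIr.
    apply/esym/big_fset_incl; first exact: fsubsetIl.
    move=> e eF; rewrite !inE eF /= in_fset_set// => /negP eT.
    have AA : A (src e) = A (tgt e) by apply: contrapT => H; exact/eT/mem_set.
    have AE : (tgt e \in A) = (src e \in A) by apply/idP/idP; rewrite !in_setE AA.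
    by rewrite !indicE AE subrr expr0n mul0r.
  by rewrite -/(energy F _) F1E; exact: energy_mono.
have Slb : has_lbound S.
  by exists 0 => B [w _ /(_ fset0)]; apply: le_trans; exact: energy_ge0.
have approx n : exists w, [/\ admissible D A w,
    forall F, energy F w <= inf S + n.+1%:R^-1 &
    forall v, D v -> laplacian w v ^+ 2 <= conductance v / n.+1%:R].
  have [B [w wK wB] BI] := @inf_adherent _ S n.+1%:R^-1 ltac:(by []) (conj Sne Slb).
  exists w; split=> // [F|v Dv]; first by rewrite (le_trans (wB F))// ltW.
  have := conductance_ge0 v; rewrite le_eqVlt => /predU1P[c0|c0].
    rewrite -c0 mul0r /laplacian big_seq big1 ?expr0n//= => e ev.
    have : (len e)^-1 <= conductance v.
      rewrite /conductance (big_fsetD1 e)//= lerDl sumr_ge0// => e' _.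
      by rewrite invr_ge0 len_ge0.
    by rewrite -c0 leNgt invr_gt0 len_gt0.
  (* Averaging at the single vertex [v] keeps [w] admissible. As [B] exceeds the infimum by less
     than [n.+1%:R^-1], the energy cannot drop by more than that. *)
  have : S (B - laplacian w v ^+ 2 / conductance v).
    exists (averaged w v); case: wK => w01 wD wfin.
      split.
      - by move=> x; rewrite /averaged; case: eqP => // _; exact: average_bounded.
      - by move=> x; rewrite /averaged; case: eqP => [->//|_]; exact: wD.
      - apply: (@sub_finite_set _ _ (v |` [set v | w v <> \1_A v])).
          by move=> x; rewrite /averaged /=; case: eqP => [->|_]; [left|right].
        by rewrite finite_setU; split.
    move=> F.
    apply: (@le_trans _ _ (energy (F `|` incident_fset v)%fset (averaged w v))).
      by apply: energy_mono; exact: fsubsetUl.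
    by rewrite energy_averaged ?fsubsetUr// lerD2r.
  move=> /(ge_inf Slb) IB.
  rewrite mulrC -ler_pdivrMr// -(lerD2l (inf S)); apply: le_trans (ltW BI).
  by rewrite -lerBrDr.
have [w wP] := choice approx.
have w1 n v : `|w n v| <= 1.
  by have [[/(_ v)/andP[w0 w1] _ _] _ _] := wP n; rewrite ger0_norm.
have [FF [FP oF] [u wu]] := bounded_pointwise_limit w1.
exists u; first split.
- by move=> v; apply: (cvgr_to_le (cvg_norm (wu v))); apply: nearW => n; exact: w1.
- move=> v Dv; apply/eqP; rewrite -normr_le0.
  apply: (cvgr_to_le (cvg_norm (wu v))); apply: nearW => n.
  by have [[_ -> //]] := wP n; rewrite normr0.
- move=> v Dv; have lapc := @laplacian_cvg FF w u v FP wu.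
  have lap2 : laplacian (w n) v ^+ 2 @[n --> FF] --> laplacian u v ^+ 2.
    by under eq_fun do rewrite expr2; rewrite expr2; exact: cvgM.
  have le0 N : laplacian u v ^+ 2 <= conductance v / N.+1%:R.
    apply: (cvgr_to_le lap2); apply: oF; exists N => // n /= Nn.
    have [_ _ /(_ v Dv)/le_trans] := wP n; apply.
    by rewrite ler_wpM2l ?conductance_ge0// lef_pV2 ?posrE// ler_nat.
  apply/eqP; rewrite -sqrf_eq0 eq_le sqr_ge0 andbT.
  have h0 : conductance v * @harmonic R N @[N --> \oo] --> conductance v * 0.
    by apply: cvgMr; exact: cvg_harmonic.
  by rewrite -[leRHS](mulr0 (conductance v)); apply: (cvgr_to_ge h0); apply: nearW.
(* This constant bounds the energies of the whole minimizing sequence, so any closed bound shared by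
   the admissible functions of such energy passes to the limit [u]. *)
exists (`|inf S| + 1); first by rewrite ltr_wpDl.
move=> v c d wd.
have wc : `|w n v - c| @[n --> FF] --> `|u v - c|.
  by apply: cvg_norm; apply: cvgB => //; exact: cvg_cst.
apply: (cvgr_to_le wc); apply: nearW => n; have [wK wE _] := wP n.
apply: wd => // F; apply: (le_trans (wE F)).
by rewrite lerD ?ler_norm// invf_le1// ler1n.
Qed.
End Energy.

(** * From unbounded energies to infinite energy *)

Section GlidingHump.
Context {R : realType} {G : metric_graph R}.
Implicit Types (D : set (vertex G)) (u w : vertex G -> R) (v : vertex G).
Implicit Types (F : {fset edge G}).

Lemma energy_parallelogram F u w :
  energy F (fun v => u v + w v) + energy F (fun v => u v - w v) =
  2 * energy F u + 2 * energy F w.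
Proof.
by rewrite /energy !mulr_sumr -!big_split /=; apply: eq_bigr => e _; ring.
Qed.

Lemma energyZ F c u : energy F (fun v => c * u v) = c ^+ 2 * energy F u.
Proof. by rewrite /energy mulr_sumr; apply: eq_bigr => e _; ring. Qed.

Lemma laplacianD u w c v :
  laplacian (fun x => u x + c * w x) v = laplacian u v + c * laplacian w v.
Proof.
by rewrite /laplacian mulr_sumr -big_split; apply: eq_bigr => e _ /=; ring.
Qed.

Lemma harmonic_ball_energy D F :
  exists M, forall u, harmonic_ball D u -> energy F u <= M.
Proof.
exists (\sum_(e <- F) 4 / len e) => u [u1 _ _]; apply: ler_sum => e _.
rewrite ler_pM2r ?invr_gt0 ?len_gt0//.
have := u1 (tgt e); have := u1 (src e); rewrite !ler_norml => /andP[? ?] /andP[? ?].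
nra.
Qed.

(* Gliding hump, in Sokal's form of the proof of the uniform boundedness
   principle. *)
Lemma infinite_energy D :
  (forall B, exists2 u, harmonic_ball D u & exists F, B < energy F u) ->
  exists2 u, harmonic_ball D u & forall B, exists F, B < energy F u.
Proof.
(* The [n]-th hump has size [q n]; the later ones add up to at most [q n / 2]. *)
move=> unb; pose p n : R := 3^-1 ^+ n; pose q n := p n.+1.
have p0 n : 0 < p n by rewrite exprn_gt0 ?invr_gt0.
have pS n : p n.+1 = p n / 3 by rewrite /p exprSr.
have q0 n : 0 < q n by exact: p0.
(* [s] is the supremum of the energies on [F] over the ball, and [u] attains at least three quarters
   of it. *)
have hump n : exists sFu : R * {fset edge G} * (vertex G -> R),
    let: (s, F, u) := sFu in [/\ harmonic_ball D u, 8 * n%:R / q n ^+ 2 <= s,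
      3 / 4 * s <= energy F u & forall w, harmonic_ball D w -> energy F w <= s].
  have [u uD [F uF]] := unb (Num.max 1 (8 * n%:R / q n ^+ 2)).
  move: uF; rewrite gt_max => /andP[u1F uF].
  pose S := [set energy F w | w in harmonic_ball D].
  have Sub : has_ubound S.
    by have [M MP] := harmonic_ball_energy D F; exists M => _ [w + <-]; exact: MP.
  have Ssup : has_sup S by split=> //; exists (energy F u), u.
  have uS : energy F u <= sup S by apply: ub_le_sup => //; exists u.
  have e0 : 0 < sup S / 4 by lra.
  have [_ [w wD <-] wS] := sup_adherent e0 Ssup.
  exists (sup S, F, w); split=> //; first lra.
  - lra.
  - by move=> w' w'D; apply: ub_le_sup => //; exists w'.
have [sFu sFuP] := choice hump.
pose s n := (sFu n).1.1; pose F n := (sFu n).1.2; pose u n := (sFu n).2.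
have uD n : harmonic_ball D (u n).
  by rewrite /u; have := sFuP n; case: (sFu n) => -[? ?] ? [].
have sn n : 8 * n%:R / q n ^+ 2 <= s n.
  by rewrite /s; have := sFuP n; case: (sFu n) => -[? ?] ? [].
have su n : 3 / 4 * s n <= energy (F n) (u n).
  by rewrite /s /F /u; have := sFuP n; case: (sFu n) => -[? ?] ? [].
have sE n w : harmonic_ball D w -> energy (F n) w <= s n.
  by rewrite /s /F; have := sFuP n; case: (sFu n) => -[? ?] ? [_ _ _]; apply.
(* By the parallelogram identity, one of the two signs does not let the earlier partial sum cancel
   the hump. *)
have sign (ny : nat * (vertex G -> R)) : exists c, `|c| = q ny.1 /\
    q ny.1 ^+ 2 * energy (F ny.1) (u ny.1) <=
    energy (F ny.1) (fun v => ny.2 v + c * u ny.1 v).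
  case: ny => n y /=.
  have := energy_parallelogram (F n) y (fun v => q n * u n v); rewrite energyZ.
  have := energy_ge0 (F n) y; set a := energy _ (fun v => y v + _).
  set b := energy _ (fun v => y v - _) => ? ?.
  have [ab|ba] := leP a b; last first.
    by exists (q n); rewrite gtr0_norm//; split=> //; rewrite -/a; lra.
  exists (- q n); rewrite normrN gtr0_norm//; split=> //.
  suff -> : (fun v => y v + - q n * u n v) = (fun v => y v - q n * u n v).
    by rewrite -/b; lra.
  by apply/funext => v; rewrite mulNr.
have [c cP] := choice sign.
pose x := fix x n : vertex G -> R :=
  if n is k.+1 then fun v => x k v + c (k, x k) * u k v else fun=> 0.
have xS n v : x n.+1 v = x n v + c (n, x n) * u n v by [].
have xF n : q n ^+ 2 * energy (F n) (u n) <= energy (F n) (x n.+1).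
  by have [] := cP (n, x n).
have xx n k v : `|x (n + k)%N v - x n v| <= (p n - p (n + k)%N) / 2.
  elim: k => [|k IH]; first by rewrite addn0 !subrr normr0 mul0r.
  rewrite addnS xS addrAC; apply: le_trans (ler_normD _ _) _.
  have : `|c ((n + k)%N, x (n + k)%N) * u (n + k)%N v| <= p (n + k)%N / 3.
    rewrite normrM; have [-> _] := cP ((n + k)%N, x (n + k)%N).
    have [/(_ v) u1 _ _] := uD (n + k)%N.
    by rewrite /q pS ler_piMr// divr_ge0// ltW.
  by move: IH; rewrite pS; lra.
have xp n k v : `|x (n + k)%N v - x n v| <= p n / 2.
  by apply: le_trans (xx n k v) _; have := p0 (n + k)%N; lra.
have x1 n v : `|x n v| <= 1.
  by have := xp 0%N n v; rewrite add0n /= subr0 /p expr0; lra.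
have xD n v : ~ D v -> x n v = 0.
  move=> Dv; elim: n => //= n ->; have [_ /(_ v Dv)-> _] := uD n.
  by rewrite mulr0 addr0.
have xh n v : D v -> laplacian (x n) v = 0.
  move=> Dv; elim: n => [|n IH].
    by rewrite /laplacian /= big1// => e _; rewrite subrr mul0r.
  by rewrite laplacianD IH; have [_ _ /(_ v Dv)->] := uD n; rewrite mulr0 addr0.
have [FF [FP oF] [X xX]] := bounded_pointwise_limit x1.
have XD v : ~ D v -> X v = 0.
  move=> Dv; apply/eqP; rewrite -normr_le0.
  by apply: (cvgr_to_le (cvg_norm (xX v))); apply: nearW => n; rewrite xD// normr0.
have Xh v : D v -> laplacian X v = 0.
  move=> Dv; apply/eqP; rewrite -normr_le0.
  have lapc := @laplacian_cvg _ _ FF x X v FP xX.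
  by apply: (cvgr_to_le (cvg_norm lapc)); apply: nearW => n; rewrite xh// normr0.
have Xx n v : `|X v - x n v| <= p n / 2.
  have wc : `|x k v - x n v| @[k --> FF] --> `|X v - x n v|.
    by apply: cvg_norm; apply: cvgB => //; exact: cvg_cst.
  apply: (cvgr_to_le wc); apply: oF; exists n => // k /= nk.
  by rewrite -(subnKC nk).
exists X.
  split=> // v.
  by apply: (cvgr_to_le (cvg_norm (xX v))); apply: nearW.
move=> B; pose n := (Num.truncn B).+1.
have Bn : B < n%:R by exact: truncnS_gt.
exists (F n); apply: (lt_le_trans Bn).
(* The rescaled remainder lies in the ball, so the energy of the remainder on [F n] is at most
   [q n ^+ 2 / 4 * s n]. *)
have hD : harmonic_ball D (fun v => 2 / q n * (X v - x n.+1 v)).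
  split=> v.
  - rewrite normrM gtr0_norm ?divr_gt0// mulrAC ler_pdivrMr// mul1r.
    by have := Xx n.+1 v; rewrite /q; lra.
  - by move=> Dv; rewrite XD// xD// subrr mulr0.
  - move=> Dv.
    rewrite (_ : (fun v => _) = fun v => 0 + 2 / q n * (X v + -1 * x n.+1 v)).
      rewrite laplacianD laplacianD Xh// xh// mulr0 addr0 mulr0 addr0.
      by rewrite /laplacian big1// => e _; rewrite subrr mul0r.
    by apply/funext => z; rewrite add0r mulN1r.
have := sE n _ hD; rewrite energyZ => hE.
have qq0 : 0 < q n ^+ 2 by rewrite exprn_gt0.
have {}hE : energy (F n) (fun v => X v - x n.+1 v) <= q n ^+ 2 / 4 * s n.
  apply: le_trans (_ : q n ^+ 2 / 4 * ((2 / q n) ^+ 2 *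
    energy (F n) (fun v => X v - x n.+1 v)) <= _); last first.
    by rewrite ler_pM2l// divr_gt0.
  rewrite mulrA (_ : q n ^+ 2 / 4 * (2 / q n) ^+ 2 = 1) ?mul1r//.
  by move: (q n) (q0 n) => z z0; field; rewrite gt_eqF.
have := energy_parallelogram (F n) (fun v => X v - x n.+1 v) (x n.+1).
have -> : (fun v => X v - x n.+1 v + x n.+1 v) = X.
  by apply/funext => v; rewrite subrK.
(* On [F n], the energy of [x n.+1] is at most twice that of [X] plus twice that of the remainder.
   Hence [X] has energy at least [(3 / 8 - 1 / 4) * q n ^+ 2 * s n], which is at least [n]. *)
have := energy_parallelogram (F n) X (fun v => X v - x n.+1 v).
have -> : (fun v => X v - (X v - x n.+1 v)) = x n.+1.
  by apply/funext => v; rewrite subKr.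
have := energy_ge0 (F n) (fun v => X v + (X v - x n.+1 v)).
have qs : 8 * n%:R <= q n ^+ 2 * s n by rewrite [leRHS]mulrC -ler_pdivrMr.
have : q n ^+ 2 * (3 / 4 * s n) <= energy (F n) (x n.+1).
  by apply: le_trans (xF n); rewrite ler_pM2l.
lra.
Qed.
End GlidingHump.

(** * Harmonic functions separating two ends *)

Section Separation.
Context {R : realType} {G : metric_graph R}.
Implicit Types (D X Y A : set (vertex G)) (u w : vertex G -> R) (v : vertex G).
Implicit Types (F : {fset edge G}) (r : nat -> vertex G).

Definition finite_length D := exists M : R, forall F,
  {in F, forall e, D (src e) \/ D (tgt e)} -> \sum_(e <- F) len e <= M.

(** A finite edge set [F0] exhausts the total length up to [eps]. With [Z] the set of its sources,
    an edge whose source is off [Z] is not in [F0]. *)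
Lemma small_length D (eps : R) : finite_length D -> 0 < eps ->
  exists2 Z, finite_set Z & forall F,
    {in F, forall e, D (src e) /\ ~ Z (src e)} -> \sum_(e <- F) len e <= eps.
Proof.
move=> [M DM] e0; pose touch F := {in F, forall e, D (src e) \/ D (tgt e)}.
pose S := [set \sum_(e <- F) len e | F in touch].
have Sub : has_ubound S by exists M => _ [F + <-]; exact: DM.
have Ssup : has_sup S.
  by split=> //; exists (\sum_(e <- (fset0 : {fset edge G})) len e), fset0.
have [_ [F0 F0D <-] F0S] := sup_adherent e0 Ssup.
exists [set src e | e in [set` F0]]; first by apply: finite_image; exact: finite_fset.
move=> F FD.
have FF0 e : e \in F -> e \notin F0.
  by move=> eF; apply/negP => eF0; have [_] := FD e eF; apply; exists e.
have : S (\sum_(e <- (F0 `|` F)%fset) len e).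
  exists (F0 `|` F)%fset => // e; rewrite inE => /orP[/F0D//|/FD[? _]]; by left.
move=> /(ub_le_sup Sub); rewrite (big_fsetID _ (mem F0)) /=.
have -> : [fset e in F0 `|` F | e \in F0]%fset = F0.
  by apply/fsetP => e; rewrite !inE /= andb_orl andbb; case: (e \in F0); rewrite ?andbF.
have -> : [fset e in F0 `|` F | e \notin F0]%fset = F.
  apply/fsetP => e; rewrite !inE /=; have := FF0 e.
  by case: (e \in F0) => /=; case: (e \in F) => //= /(_ isT).
by lra.
Qed.

Lemma short_path_oscillation D Z u (B t eps : R) x p : 0 < t ->
  (forall F, {in F, forall e, D (src e) /\ ~ Z (src e)} ->
    \sum_(e <- F) len e <= eps) ->
  (forall F, energy F u <= B) ->
  path adj x p -> (forall v, v \in x :: p -> D v /\ ~ Z v) ->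
  `|u (last x p) - u x| <= (t * eps + B / t) / 2.
Proof.
move=> t0 Zeps uB xp; case/shortenP: xp => q xq xqu qp H.
apply: (path_oscillation t0 uB xq xqu) => F Fq; apply: Zeps => e /Fq[+ _].
by rewrite inE => se; apply: H; rewrite inE; case/orP: se => [->//|/qp->]; rewrite orbT.
Qed.

Lemma ray_path r n m : is_ray r -> (n <= m)%N ->
  exists p, [/\ path adj (r n) p, last (r n) p = r m &
    forall v, v \in r n :: p -> exists2 k, (n <= k)%N & v = r k].
Proof.
move=> rr nm; rewrite -(subnKC nm); elim: (m - n)%N => [|k [p [rp rl rk]]].
  exists [::]; rewrite addn0; split=> // v; rewrite inE => /eqP->.
  by exists n.
exists (rcons p (r (n + k.+1)%N)); split.
- by rewrite rcons_path rp rl addnS rr.2.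
- by rewrite last_rcons.
- move=> v; rewrite -rcons_cons mem_rcons inE => /predU1P[->|/rk//].
  by exists (n + k.+1)%N => //; rewrite leq_addr.
Qed.

(** An admissible [w] equals [c] far out on the ray, and the remaining tail is short. With length
    [1 / (16 * B)] and [t = 4 * B] the oscillation is at most [1 / 4], from an index on that does
    not depend on [w]; so the bound transfers to [u]. *)
Lemma equilibrium_on_ray D A u (B c : R) r N : finite_length D -> 0 < B ->
  (forall v (c d : R), (forall w, admissible D A w -> (forall F, energy F w <= B) ->
    `|w v - c| <= d) -> `|u v - c| <= d) ->
  is_ray r -> (forall n, (N <= n)%N -> D (r n) /\ \1_A (r n) = c) ->
  exists M, forall n, (M <= n)%N -> `|u (r n) - c| <= 1 / 4.
Proof.
move=> Dfin B0 uK rr rA; have eps0 : 0 < (16 * B)^-1 by rewrite invr_gt0 mulr_gt0.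
have [Z Zfin Zeps] := small_length Dfin eps0.
have [M rM] := ray_eventually_off rr Zfin.
exists (maxn N M) => n Mn; apply: uK => w [w01 wD wA] wB.
have [K rK] := ray_eventually_off rr wA.
have [p [rp rl rk]] := ray_path rr (leq_maxl n K).
have t0 : 0 < 4 * B by rewrite mulr_gt0.
have -> : c = w (last (r n) p).
  rewrite rl; have [_ <-] := rA (maxn n K) ltac:(lia).
  apply/esym; apply: contrapT => H; apply: (rK (maxn n K)); [lia|exact: H].
have rDZ v : v \in r n :: p -> D v /\ ~ Z v.
  move=> /rk[k nk ->]; split; first by have [] := rA k ltac:(lia).
  by apply: rM; lia.
rewrite distrC; apply: le_trans (short_path_oscillation t0 Zeps wB rp rDZ) _.
suff -> : (4 * B * (16 * B)^-1 + B / (4 * B)) / 2 = 1 / 4 by [].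
by field; rewrite gt_eqF.
Qed.

Lemma ends_unbounded_energy X x0 (omega : set (nat -> vertex G)) :
  let D := same_component_off X x0 in
  finite_set X -> finite_length D -> is_graph_end omega -> ~ free_end omega ->
  (forall r, omega r -> exists N, forall n, (N <= n)%N -> D (r n)) ->
  forall B, exists2 u, harmonic_ball D u & exists F, B < energy F u.
Proof.
move=> D Xfin Dfin omegaE nfree omegaD B'.
apply: contrapT => nex; pose B : R := Num.max B' 1.
have B0 : 0 < B by rewrite lt_max ltr01 orbT.
have {nex} uB u : harmonic_ball D u -> forall F, energy F u <= B.
  move=> uD F; rewrite leNgt; apply/negP => BF; apply: nex; exists u => //; exists F.
  by apply: le_lt_trans BF; rewrite le_max lexx.
(* With this length and [t = 2 * B], the oscillation along a path in [D] off [Z] is at most [3 / 8],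
   less than the [1 / 2] forced below. *)
have eps0 : 0 < (8 * B)^-1 by rewrite invr_gt0 mulr_gt0.
have [Z Zfin Zeps] := small_length Dfin eps0.
have XZfin : finite_set (X `|` Z) by rewrite finite_setU.
(* The finite set of the vertices of [X] and [Z] does not witness freeness, so some other end stays
   linked to this one off that set. *)
have [omega' [omega'E [ne [r [r' [or [or' linked]]]]]]] : exists omega',
    is_graph_end omega' /\ omega' <> omega /\ exists r r', omega r /\ omega' r' /\
    forall N, exists n m, [/\ (N <= n)%N, (N <= m)%N &
      same_component_off (X `|` Z) (r n) (r' m)].
  apply: contrapT => H; apply: nfree; exists (X `|` Z) => // omega' E' ne r r' or or'.
  apply: contrapT => H'; apply: H; exists omega'; split=> //; split=> //.
  exists r, r'; split=> //; split=> // N; apply: contrapT => H''; apply: H'.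
  by exists N => n m Nn Nm c; apply: H''; exists n, m.
have rr : is_ray r by case: omegaE or => ? _ -> [].
have rr' : is_ray r' by case: omega'E or' => ? _ -> [].
have [Y Yfin [N1 sep]] := distinct_ends_separable omegaE omega'E (nesym ne) or or'.
have [N2 rD] := omegaD r or.
have XYfin : finite_set (X `|` Y) by rewrite finite_setU.
have [N3 rXY] := ray_eventually_off rr XYfin.
have [N4 rXY'] := ray_eventually_off rr' XYfin.
pose N := maxn (maxn N1 N2) (maxn N3 N4).
have rX n : (N3 <= n)%N -> ~ X (r n) by move=> /rXY H Xr; apply: H; left.
have rX' n : (N4 <= n)%N -> ~ X (r' n) by move=> /rXY' H Xr; apply: H; left.
have rD' n : (N <= n)%N -> D (r' n).
  move=> Nn; have [k [m [Nk Nm c]]] := linked N.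
  have XXZ : X `<=` X `|` Z by left.
  apply: (same_component_off_trans (rD k _)); first lia.
  apply: (same_component_off_trans (same_component_off_sub XXZ c)).
  by apply: (ray_tail_connected rr' rX'); lia.
(* [A] contains the tail of [r] and misses that of [r']; every edge leaving it has an end point in
   [X] or [Y]. *)
pose A := same_component_off (X `|` Y) (r N).
have AD : A `<=` D.
  move=> v Av; apply: (same_component_off_trans (rD N _)); first lia.
  by apply: same_component_off_sub Av; left.
have rA n : (N <= n)%N -> A (r n).
  by move=> Nn; apply: (ray_tail_connected rr rXY); lia.
have rA' n : (N <= n)%N -> ~ A (r' n).
  move=> Nn An; apply: (sep N n); [lia|lia|].
  by apply: same_component_off_sub An; right.
have Aadj v1 v2 : A v1 -> adj v1 v2 -> ~ (X `|` Y) v2 -> A v2.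
  move=> A1 a12 n2; apply: (same_component_off_trans A1).
  by apply: same_component_off_adj => //; exact: same_component_offr A1.
have Afin : finite_set [set e | A (src e) <> A (tgt e)].
  apply: (@sub_finite_set _ _ (\bigcup_(v in X `|` Y) incident v)); last first.
    by apply: bigcup_finite => // v _; exact: locally_finite.
  move=> e /= Ae; have se : adj (src e) (tgt e) by apply/asboolP; exists e; left.
  have [XYs|nXYs] := pselect ((X `|` Y) (src e)); first by exists (src e) => //; left.
  have [XYt|nXYt] := pselect ((X `|` Y) (tgt e)); first by exists (tgt e) => //; right.
  exfalso; apply: Ae; apply/propext; split=> H; first exact: Aadj se nXYt.
  by apply: Aadj H _ nXYs; rewrite adj_sym.
(* [C] may depend on [Y] and serves only for the boundary values. The energy of [u] itself is
   bounded by [B], from which [Z] was chosen. *)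
have [u uD [C C0 uC]] := exists_equilibrium AD Afin.
have [M1 uM1] : exists M, forall n, (M <= n)%N -> `|u (r n) - 1| <= 1 / 4.
  apply: (equilibrium_on_ray Dfin C0 uC rr (N := N)) => n Nn.
  by split; [exact: AD (rA n Nn)|rewrite indicE mem_set//; exact: rA].
have [M2 uM2] : exists M, forall n, (M <= n)%N -> `|u (r' n) - 0| <= 1 / 4.
  apply: (equilibrium_on_ray Dfin C0 uC rr' (N := N)) => n Nn.
  by split; [exact: rD'|rewrite indicE memNset//; exact: rA'].
have [n [m [Mn Mm [p [np pm pXZ]]]]] := linked (maxn N (maxn M1 M2)).
have t0 : 0 < 2 * B by rewrite mulr_gt0.
have pD v : v \in r n :: p -> D v /\ ~ Z v.
  move=> vp; split; last by move=> Zv; apply: (pXZ v) => //; right.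
  apply: (same_component_off_trans (rD n _)); first lia.
  case/splitPl: vp np pXZ => p1 p2 <-; rewrite cat_path => /andP[np1 _] pXZ.
  exists p1; split=> // w; rewrite inE => wp Xw; apply: (pXZ w); last by left.
  by rewrite inE mem_cat orbA wp.
have := short_path_oscillation t0 Zeps (uB u uD) np pD.
rewrite pm.
have -> : (2 * B * (8 * B)^-1 + B / (2 * B)) / 2 = 3 / 8 by field; rewrite gt_eqF.
have := uM1 n ltac:(lia); have := uM2 m ltac:(lia).
by rewrite !ler_norml => /andP[? ?] /andP[? ?] /andP[? ?]; lra.
Qed.
End Separation.

(** * The topology of the metric graph *)

Section Chart.
Context {R : realType} {G : metric_graph R}.
Implicit Types (e : edge G) (v : vertex G) (t : R).

Lemma chart_inner e t (t0l : 0 < t < len e) : chart e t = Inner e t t0l.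
Proof.
rewrite /chart; case: {-}_ / idP => [h|/(_ t0l)//].
by rewrite (bool_irrelevance h t0l).
Qed.

Lemma chart0 e : chart e 0 = Vertex (src e).
Proof. by rewrite /chart; case: {-}_ / idP => [h|_]; [case/andP: (h); rewrite ltxx|rewrite lexx]. Qed.

Lemma chart_len e : chart e (len e) = Vertex (tgt e).
Proof.
rewrite /chart; case: {-}_ / idP => [h|_]; first by case/andP: (h); rewrite ltxx.
by rewrite leNgt len_gt0.
Qed.

Variant chart_spec e t : carrier G -> Type :=
| ChartSrc of t = 0 : chart_spec e t (Vertex (src e))
| ChartInner (t0l : 0 < t < len e) : chart_spec e t (Inner e t t0l)
| ChartTgt of t = len e : chart_spec e t (Vertex (tgt e)).

Lemma chartP e t : 0 <= t <= len e -> chart_spec e t (chart e t).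
Proof.
move=> /andP[]; rewrite le_eqVlt; case: eqVneq => [<- _ _|_ /= t0].
  by rewrite chart0; constructor.
rewrite le_eqVlt; case: eqVneq => [-> _|_ /= tl].
  by rewrite chart_len; constructor.
have t0l : 0 < t < len e by rewrite t0.
by rewrite (chart_inner t0l); constructor.
Qed.

Definition star v : set (carrier G) := fun x =>
  match x with
  | Vertex w => w = v
  | Inner e t _ => src e = v \/ tgt e = v
  end.

Lemma star_chart e v t : 0 <= t <= len e ->
  star v (chart e t) <-> (src e = v /\ t < len e) \/ (tgt e = v /\ 0 < t).
Proof.
have l0 := len_gt0 e; have nl := @no_loop _ _ e.
move=> /chartP[->|/[dup] /andP[t0 tl] ? /=|->] /=; rewrite ?ltxx ?t0 ?tl ?l0.
- by split=> [|[[]|[]]] //; left.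
- by split=> [[]|[[]|[]]]; [left|right|left|right].
- by split=> [|[[]|[]]] //; right.
Qed.

Lemma star_open v : open (star v).
Proof.
move=> e; apply/open_subspaceP.
exists ([set t | src e = v /\ t < len e] `|` [set t | tgt e = v /\ 0 < t]).
  apply: openU.
    have [->|?] := pselect (src e = v).
      rewrite (_ : mkset _ = [set t | t < len e]); first exact: open_lt.
      by apply/seteqP; split=> t //= [].
    rewrite (_ : mkset _ = set0); first exact: open0.
    by apply/seteqP; split=> t //= [].
  have [->|?] := pselect (tgt e = v).
    rewrite (_ : mkset _ = [set t | 0 < t]); first exact: open_gt.
    by apply/seteqP; split=> t //= [].
  rewrite (_ : mkset _ = set0); first exact: open0.
  by apply/seteqP; split=> t //= [].
by apply/seteqP; split=> t /= [H]; rewrite in_itv /= => t0l; split=> //;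
  apply/(star_chart v t0l).
Qed.

(** The vertex stars are an open cover. Along an injective numbering of the vertices, compactness
    bounds the numbers needed. *)
Lemma compact_stars (K : set (carrier G)) : compact K ->
  exists2 S, finite_set S & forall x, K x -> exists2 v, S v & star v x.
Proof.
have Vc : countable [set: vertex G].
  by rewrite (eq_countable (vertex_countably_infinite G)); exact: countableP.
have [phi phiI] := elimT (countable_injP _) Vc.
move=> /compact_near_coveringP/(_ nat \oo (fun n x => exists2 v, (phi v <= n)%N & star v x) _).
case=> [x Kx|n _ nK].
  have [v vx] : exists v, star v x.
    by case: x {Kx} => [v|e t t0l]; [exists v|exists (src e); left].
  exists (star v, [set n | (phi v <= n)%N]) => /=.
    by split; [apply: open_nbhs_nbhs; split=> //; exact: star_open|exists (phi v)].
  by move=> [y m] [/= vy vm]; exists v.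
exists [set v | (phi v <= n)%N].
  have := @finite_preimage _ _ `I_n.+1 phi; apply; last exact: finite_II.
  by move=> v w _ _; apply: phiI; exact: mem_set.
by move=> x Kx; have /(_ _ Kx) := nK n (leqnn n).
Qed.

(* Edges away from the compact boundary are connected subsets of its
   complement. *)
Lemma compact_boundary_edges (W : set (carrier G)) : open W ->
  compact (closure W `\` W^°) -> exists2 X, finite_set X &
    forall e, ~ (X (src e) /\ X (tgt e)) ->
    (forall t, 0 <= t <= len e -> W (chart e t)) \/
    (forall t, 0 <= t <= len e -> ~ W (chart e t)).
Proof.
move=> oW /compact_stars[S Sfin bS].
pose T := \bigcup_(v in S) incident v.
have Tfin : finite_set T by apply: bigcup_finite => // v _; exact: locally_finite.
exists (src @` T `|` tgt @` T).
  by rewrite finite_setU; split; exact: finite_image.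
move=> e nX.
(* A boundary point on [e] would lie in the star of a vertex of [S], which puts both end points of
   [e] into [X]. *)
have bdry t : 0 <= t <= len e -> closure W (chart e t) -> W (chart e t).
  move=> t0l cW; apply: contrapT => nW.
  have [|v Sv] := bS (chart e t); first by split=> //; move/interior_subset.
  move=> /(star_chart v t0l) ev; apply: nX.
  have Te : T e by exists v => //; case: ev => -[]; [left|right].
  by split; [left|right]; exists e.
have [[t0 [t0l Wt0]]|nW] := pselect (exists t, 0 <= t <= len e /\ W (chart e t)); last first.
  by right=> t t0l Wt; apply: nW; exists t.
(* The trace of [W] on the segment is nonempty, open and closed. *)
left; suff : `[0, len e]%classic `&` chart e @^-1` W = `[0, len e]%classic.
  by move=> H t tl; have : `[0, len e]%classic t by []; rewrite -H => -[].
apply: segment_connected.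
- by exists t0; split.
- have /open_subspaceP[V oV VW] := (oW : graph_open W) e.
  by exists V => //; rewrite setIC -VW setIC.
- have oC : open (~` closure W) by apply: closed_openC; exact: closed_closure.
  have /open_subspaceP[V oV VW] := (oC : graph_open _) e.
  exists (~` V); first exact: open_closedC.
  apply/seteqP; split=> t [tl] /= H; split=> //.
    move=> Vt; have : (V `&` `[0, len e]%classic) t by [].
    by rewrite VW => -[/= + _]; apply; exact: subset_closure.
  apply: bdry => //; apply: contrapT => nc; apply: H.
  by have : (chart e @^-1` (~` closure W) `&` `[0, len e]%classic) t by []; rewrite -VW => -[].
Qed.

(** An edge with an end point in [W] that does not have both end points in [X] lies entirely in [W].
    So a path off [X] stays in [W], and every edge touching the component contributes its full
    length to the volume. *)
Lemma finite_volume_component (W : set (carrier G)) (X : set (vertex G)) x0 :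
  (vol W < +oo)%E -> W (Vertex x0) ->
  (forall e, ~ (X (src e) /\ X (tgt e)) ->
    (forall t, 0 <= t <= len e -> W (chart e t)) \/
    (forall t, 0 <= t <= len e -> ~ W (chart e t))) ->
  finite_length (same_component_off X x0).
Proof.
move=> Wfin Wx0 We.
have e0 e : 0 <= (0 : R) <= len e by rewrite lexx len_ge0.
have el e : 0 <= len e <= len e by rewrite lexx len_ge0.
have WD v : same_component_off X x0 v -> W (Vertex v).
  move=> [p [+ <-]]; elim/last_ind: p => [//|p y IH] + pX.
  rewrite rcons_path last_rcons => /andP[xp /asboolP[e ey]].
  have Wl : W (Vertex (last x0 p)).
    apply: IH => // w wp; apply: pX; rewrite -rcons_cons mem_rcons inE.
    by rewrite wp orbT.
  have Xy : ~ X y by apply: pX; rewrite -rcons_cons mem_rcons mem_head.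
  have nX : ~ (X (src e) /\ X (tgt e)) by case: ey => -[-> ->] [].
  have [H|H] := We e nX.
    case: ey => [[_ <-]|[<- _]]; first by rewrite -chart_len; exact: H.
    by rewrite -chart0; exact: H.
  exfalso; have := H _ (e0 e); have := H _ (el e); rewrite chart0 chart_len.
  by case: ey => -[-> ->].
have lenE e : same_component_off X x0 (src e) \/ same_component_off X x0 (tgt e) ->
    lebesgue_measure (`[0, len e] `&` chart e @^-1` W) = (len e)%:E.
  move=> eD; have nX : ~ (X (src e) /\ X (tgt e)).
    by case: eD => /same_component_offr ? [].
  have [H|H] := We e nX; last first.
    exfalso; have := H _ (e0 e); have := H _ (el e); rewrite chart0 chart_len.
    by case: eD => /WD.
  rewrite (_ : _ `&` _ = `[0, len e]%classic); last first.
    by apply/seteqP; split=> t [] //= t0l; split=> //; exact: H.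
  by rewrite lebesgue_measure_itv /= lte_fin len_gt0 sube0.
exists (fine (vol W)) => F FD.
have Wnn : (0 <= vol W)%E by apply: esum_ge0 => e _; exact: measure_ge0.
rewrite -lee_fin fineK ?ge0_fin_numE//.
apply: esum_ge; exists [set` F]; first by split=> //; exact: finite_fset.
rewrite fsbig_finite ?set_fsetK/=; last exact: finite_fset.
rewrite -sumEFin le_eqVlt; apply/orP; left; apply/eqP.
by apply: eq_big_seq => e /FD /lenE ->.
Qed.
End Chart.

(** * Functions on the edges *)

Section HornerInterval.
Context {R : realType}.
Implicit Types (p : {poly R}) (l t : R).
Local Notation mu := (@lebesgue_measure R).

Lemma integrable_horner p (a b : R) : mu.-integrable `[a, b] (EFin \o horner p).
Proof.
apply: continuous_compact_integrable; first exact: segment_compact.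
by apply: continuous_subspaceT; exact: continuous_horner.
Qed.

Lemma L2_sqnorm_lty p l : (L2_sqnorm l (horner p) < +oo)%E.
Proof.
have -> : L2_sqnorm l (horner p) = (\int[mu]_(t in `[0%R, l]) ((p ^+ 2).[t])%:E)%E.
  by apply: eq_integral => t _; rewrite horner_exp.
by apply: integrable_lty => //; exact: integrable_horner.
Qed.

Lemma L2_interval_horner p l : L2_interval l (horner p).
Proof. by split; [exact: measurable_poly|exact: L2_sqnorm_lty]. Qed.

Lemma Rintegral_deriv_horner p t : 0 <= t ->
  \int[mu]_(s in `[0, t]) (p^`()).[s] = p.[t] - p.[0].
Proof.
rewrite le_eqVlt => /predU1P[<-|t0].
  by rewrite set_itv1 Rintegral_set1 subrr.
rewrite /Rintegral (@continuous_FTC2 _ _ (horner p))//.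
- by apply: continuous_subspaceT; exact: continuous_horner.
- split.
  + by move=> x _; exact: derivable_horner.
  + by apply: cvg_at_right_filter; exact: continuous_horner.
  + by apply: cvg_at_left_filter; exact: continuous_horner.
- by move=> x _; rewrite derive1E; have := is_derive_poly p x => ?; rewrite derive_val.
Qed.

Lemma H1_deriv_horner p l (g : R -> R) :
  (forall t, 0 <= t <= l -> g t = p.[t]) -> H1_deriv l g (horner p^`()).
Proof.
move=> gp; split; first exact: L2_interval_horner.
move=> t; rewrite in_itv /= => /[dup] t0l /andP[t0 tl].
rewrite Rintegral_deriv_horner// !gp//; first by rewrite addrC subrK.
by rewrite lexx (le_trans t0).
Qed.

(** Cauchy-Schwarz, obtained by integrating [(u' - c) ^+ 2 >= 0] with [c] the mean slope of [u]. *)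
Lemma H1_deriv_increment l (u u' : R -> R) : 0 < l -> H1_deriv l u u' ->
  (((u l - u 0) ^+ 2 / l)%:E <= L2_sqnorm l u')%E.
Proof.
move=> l0 [[mu' u'2] /(_ l)]; rewrite in_itv /= lexx ltW// => /(_ isT) ul.
have mI : measurable (`[0, l]%classic : set R) by exact: measurable_itv.
have iu'2 : mu.-integrable `[0, l] (EFin \o (fun t => u' t ^+ 2)).
  apply/integrableP; split.
    by apply/measurable_EFinP; exact: measurable_funX.
  apply: le_lt_trans u'2; apply: ge0_le_integral => //.
  - by apply: measurableT_comp => //; apply/measurable_EFinP; exact: measurable_funX.
  - by apply/measurable_EFinP; exact: measurable_funX.
  - by move=> t _ /=; rewrite ger0_norm ?sqr_ge0.
have icst (c : R) : mu.-integrable `[0, l] (EFin \o cst c).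
  have -> : cst c = horner c%:P by apply/funext => t; rewrite hornerC.
  exact: integrable_horner.
have iu' : mu.-integrable `[0, l] (EFin \o u').
  apply: (@le_integrable _ _ _ mu _ mI (EFin \o u') (EFin \o (fun t => 1 + u' t ^+ 2))) => //.
  - exact/measurable_EFinP.
  - move=> t _; rewrite /= lee_fin [leRHS]ger0_norm ?addr_ge0 ?sqr_ge0// ler_norml.
    by apply/andP; split; nra.
  - exact: (@integrableD _ _ _ mu _ mI _ _ (icst 1) iu'2).
have uI : u l - u 0 = \int[mu]_(s in `[0, l]) u' s by rewrite ul addrC addKr.
pose c := (u l - u 0) / l.
have icu' : mu.-integrable `[0, l] (EFin \o (fun t => 2 * c * u' t)).
  exact: (@integrableZl _ _ _ mu _ mI (2 * c) _ iu').
have -> : L2_sqnorm l u' = (\int[mu]_(s in `[0, l]) (u' s ^+ 2))%:E.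
  by rewrite /Rintegral fineK//; exact: integrable_fin_num.
rewrite lee_fin.
have -> : (u l - u 0) ^+ 2 / l = \int[mu]_(s in `[0, l]) (2 * c * u' s - c ^+ 2).
  rewrite RintegralB//; last exact: icst.
  have muI := lebesgue_measure_itv `[0, l]; rewrite /= lte_fin l0 sube0 in muI.
  rewrite RintegralZl// -uI Rintegral_cst// [fine _](congr1 fine muI) /=.
  by rewrite /c; field; rewrite gt_eqF.
apply: le_Rintegral => //.
  exact: (@integrableB _ _ _ mu _ mI _ _ icu' (icst (c ^+ 2))).
by move=> t _; rewrite -subr_ge0 (_ : _ - _ = (u' t - c) ^+ 2) ?sqr_ge0//; ring.
Qed.
End HornerInterval.

(** * The function on the metric graph and its membership in the two spaces *)

Section Interpolant.
Context {R : realType} {G : metric_graph R}.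
Implicit Types (e : edge G) (v : vertex G) (t : R) (F : {fset edge G}).

(** Comparison of series up to finitely many terms; it isolates the edges carrying cubic
    corrections. *)
Lemma esum_lty_cofinite (g h : edge G -> \bar R) (T : set (edge G)) :
  finite_set T -> (forall e, 0 <= g e < +oo)%E -> (forall e, 0 <= h e)%E ->
  (forall e, ~ T e -> (g e <= h e)%E) -> (\esum_(e in [set: edge G]) h e < +oo)%E ->
  (\esum_(e in [set: edge G]) g e < +oo)%E.
Proof.
move=> Tfin gfin h0 gh hfin.
have g0 e : (0 <= g e)%E by case/andP: (gfin e).
rewrite (esumID T)//; apply: lte_add_pinfty.
  rewrite esum_fset//; last exact: finite_setIr.
  rewrite fsbig_finite; last exact: finite_setIr.
  by apply: lte_sum_pinfty => e _; case/andP: (gfin e).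
apply: le_lt_trans hfin.
rewrite [leRHS](esumID (~` T))//; apply: (@le_trans _ _ (\esum_(e in setT `&` ~` T) h e)%E).
  by apply: le_esum => e [_ /gh].
by rewrite leeDl// esum_ge0.
Qed.

Variables (U : vertex G -> R) (X D : set (vertex G)).
Hypothesis U1 : forall v, `|U v| <= 1.
Hypothesis UD : forall v, ~ D v -> U v = 0.
Hypothesis Dfin : finite_length D.
Hypothesis Xfin : finite_set X.
Hypothesis UX : forall v, ~ X v -> laplacian U v = 0.
Hypothesis Uinf : forall B, exists F, B < energy F U.

(** The denominator is the degree of [v]: the missing slope is shared equally by the incident
    edges. *)
Definition defect v := laplacian U v / \sum_(e <- incident_fset v) 1.

(* Linear interpolation, corrected by cubics whose slopes at the end points
   compensate the defect of the Kirchhoff condition. *)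
Definition edge_poly e : {poly R} :=
  (U (src e))%:P + ((U (tgt e) - U (src e)) / len e) *: 'X +
  (defect (src e) / len e ^+ 2) *: ('X * ((len e)%:P - 'X) ^+ 2) +
  (defect (tgt e) / len e ^+ 2) *: ('X ^+ 2 * ((len e)%:P - 'X)).

Definition interpolant (x : carrier G) : R :=
  match x with
  | Vertex v => U v
  | Inner e t _ => (edge_poly e).[t]
  end.

Let hornerS := (hornerD, hornerN, hornerZ, hornerM, horner_exp, hornerX, hornerC).

Lemma edge_polyE e t : (edge_poly e).[t] =
  U (src e) + (U (tgt e) - U (src e)) / len e * t +
  defect (src e) / len e ^+ 2 * (t * (len e - t) ^+ 2) +
  defect (tgt e) / len e ^+ 2 * (t ^+ 2 * (len e - t)).
Proof. by rewrite /edge_poly !hornerS. Qed.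

Lemma interpolant_chart e t : 0 <= t <= len e ->
  interpolant (chart e t) = (edge_poly e).[t].
Proof.
have l0 := len_gt0 e.
move=> /chartP[->|//|->] /=; rewrite edge_polyE; field; rewrite gt_eqF//.
Qed.

Lemma interpolant_continuous : continuous interpolant.
Proof.
apply/continuousP => O oO; move=> e; apply/open_subspaceP.
exists (horner (edge_poly e) @^-1` O).
  by have /continuousP := @continuous_horner _ (edge_poly e); apply.
by apply/seteqP; split=> t /= [Ot t0l]; split=> //;
  move: Ot; rewrite interpolant_chart.
Qed.

(** Each cubic vanishes at both end points, has outward slope [defect] at its own vertex and a
    double zero at the other, so the two corrections do not interfere. *)
Lemma outward_deriv_interpolant e v : incident v e ->
  outward_deriv interpolant v e = (U (other e v) - U v) / len e + defect v.
Proof.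
have l0 := len_gt0 e; have nl := @no_loop _ _ e.
(* For small positive [h] the difference quotient is a polynomial in [h], whose value at 0 is the
   limit. *)
have lim_right (g : R -> R) (p : {poly R}) :
    (forall h, 0 < h < len e -> g h = p.[h]) -> lim (g h @[h --> 0^'+]) = p.[0].
  move=> gp; apply: cvg_lim => //.
  apply: cvg_trans (cvg_at_right_filter (@continuous_horner _ p 0)).
  apply: near_eq_cvg; near=> h; apply/esym/gp; apply/andP; split.
    by near: h; exact: nbhs_right_gt.
  by near: h; exact: nbhs_right_lt.
have e0 : 0 <= (0 : R) <= len e by rewrite lexx ltW.
have el : 0 <= len e <= len e by rewrite lexx ltW.
move=> ev; rewrite /outward_deriv /other.
case: eqP => [->|vs].
  rewrite (lim_right _ (((U (tgt e) - U (src e)) / len e)%:P +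
    (defect (src e) / len e ^+ 2) *: ((len e)%:P - 'X) ^+ 2 +
    (defect (tgt e) / len e ^+ 2) *: ('X * ((len e)%:P - 'X)))).
    by rewrite !hornerS; field; rewrite gt_eqF.
  move=> h /andP[h0 hl].
  rewrite !interpolant_chart//; last by rewrite !ltW.
  by rewrite !edge_polyE !hornerS; field; rewrite !gt_eqF.
have {ev vs} -> : v = tgt e by case: ev => [/esym//|->].
rewrite (lim_right _ (((U (src e) - U (tgt e)) / len e)%:P +
  (defect (tgt e) / len e ^+ 2) *: ((len e)%:P - 'X) ^+ 2 +
  (defect (src e) / len e ^+ 2) *: ('X * ((len e)%:P - 'X)))).
  by rewrite !hornerS; field; rewrite gt_eqF.
move=> h /andP[h0 hl].
rewrite !interpolant_chart//; last by rewrite subr_ge0 ltW//= gerBl ltW.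
by rewrite !edge_polyE !hornerS; field; rewrite !gt_eqF.
Unshelve. all: by end_near.
Qed.

Lemma interpolant_kirchhoff v : kirchhoff interpolant v.
Proof.
split; first exact: interpolant_continuous.
rewrite fsbig_finite; last exact: locally_finite.
rewrite -/(incident_fset v).
have -> : \sum_(e <- incident_fset v) outward_deriv interpolant v e =
    \sum_(e <- incident_fset v) (defect v * 1 - (U v - U (other e v)) / len e).
  apply: eq_big_seq => e; rewrite in_incident_fset => ev.
  rewrite outward_deriv_interpolant; first by ring.
  by case/orP: ev => /eqP ev; [left|right].
rewrite sumrB -mulr_sumr -/(laplacian U v).
have [v0|[e ev]] := fset_0Vmem (incident_fset v).
  by rewrite /laplacian v0 !big_seq_fset0 mulr0 subrr.
rewrite mulfVK ?subrr// gt_eqF//.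
rewrite (big_fsetD1 e)//= ltr_wpDr// sumr_ge0//.
Qed.

Lemma interpolant_H1_deriv e :
  H1_deriv (len e) (component interpolant e) (horner (edge_poly e)^`()).
Proof. by apply: H1_deriv_horner => t; exact: interpolant_chart. Qed.

Lemma L2_sqnorm_component e :
  L2_sqnorm (len e) (component interpolant e) = L2_sqnorm (len e) (horner (edge_poly e)).
Proof.
apply: eq_integral => t /set_mem; rewrite /= in_itv /= => t0l.
by rewrite /component interpolant_chart.
Qed.

Lemma L2_sqnorm_ge0 l (u : R -> R) : (0 <= L2_sqnorm l u)%E.
Proof. by apply: integral_ge0 => t _; rewrite lee_fin sqr_ge0. Qed.

Let T := \bigcup_(v in X) incident v.

Let Tfin : finite_set T.
Proof. by apply: bigcup_finite => // v _; exact: locally_finite. Qed.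

Lemma edge_poly_linear e : ~ T e ->
  edge_poly e = (U (src e))%:P + ((U (tgt e) - U (src e)) / len e) *: 'X.
Proof.
move=> Te; rewrite /edge_poly /defect !UX ?mul0r ?scale0r ?addr0//.
- by move=> Xt; apply: Te; exists (tgt e) => //; right.
- by move=> Xs; apply: Te; exists (src e) => //; left.
Qed.

Lemma interpolant_L2 : L2_graph (component interpolant).
Proof.
have int01 e : L2_interval (len e) (component interpolant e).
  split; last by rewrite L2_sqnorm_component L2_sqnorm_lty.
  apply: (eq_measurable_fun (horner (edge_poly e))); last exact: measurable_poly.
  move=> t /set_mem; rewrite /= in_itv /= => t0l.
  by rewrite /component interpolant_chart.
split=> //.
(* Off [T] the function is linear with end values in [[-1, 1]], and zero unless [e] touches [D], so
   its squared norm is at most the length of an edge touching [D]. *)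
pose touch e := `[< D (src e) \/ D (tgt e) >].
apply: (esum_lty_cofinite (h := fun e => (if touch e then len e else 0)%:E) Tfin).
- by move=> e; rewrite L2_sqnorm_ge0; have [_ ->] := int01 e.
- by move=> e; rewrite lee_fin; case: ifP => // _; exact: len_ge0.
- move=> e Te; have l0 := len_gt0 e; rewrite L2_sqnorm_component edge_poly_linear//.
  set c : R := if touch e then 1 else 0.
  have -> : (if touch e then len e else 0)%:E =
      (\int[lebesgue_measure]_(t in `[0%R, len e]) (cst c%:E) t)%E.
    have muI := lebesgue_measure_itv `[0, len e]; rewrite /= lte_fin l0 sube0 in muI.
    rewrite integral_cst// [X in (_ * X)%E]muI.
    by rewrite /c; case: ifP; rewrite ?mul1e ?mul0e.
  apply: ge0_le_integral => //.
  + by move=> t _; rewrite lee_fin sqr_ge0.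
  + by apply/measurable_EFinP; apply: measurable_funX; exact: measurable_poly.
  + move=> t /=; rewrite in_itv /= lee_fin => /andP[t0 tl]; rewrite !hornerS /c /touch.
    case: asboolP => [_|/not_orP[Ds Dt]]; last first.
      by rewrite !UD// subrr !mul0r addr0 expr0n.
    have := U1 (src e); have := U1 (tgt e); rewrite !ler_norml.
    move=> /andP[a1 a2] /andP[b1 b2].
    pose s := t / len e; rewrite mulrAC -mulrA -/s.
    have s0 : 0 <= s by rewrite divr_ge0// ltW.
    have s1 : s <= 1 by rewrite ler_pdivrMr// mul1r.
    set y := _ + _.
    have y1 : -1 <= y <= 1 by rewrite /y; apply/andP; split; nra.
    by have /andP[? ?] := y1; nra.
have [M DM] := Dfin; apply: (@le_lt_trans _ _ M%:E); last exact: ltry.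
apply: ub_ereal_sup => _ [A [Afin _] <-].
rewrite fsbig_finite// sumEFin lee_fin.
rewrite -big_mkcond big_fset_condE; apply: DM => e.
by rewrite !inE /= => /andP[_ /asboolP].
Qed.

(** The second derivative vanishes off the finitely many edges at [X], so its square integrability
    only concerns finitely many polynomials. *)
Lemma interpolant_dom_H : dom_H interpolant.
Proof.
split; [exact: interpolant_L2| |exact: interpolant_kirchhoff].
exists (fun e => horner (edge_poly e)^`()), (fun e => horner (edge_poly e)^`()^`()).
split.
  move=> e; split; first exact: interpolant_H1_deriv.
  exact: H1_deriv_horner.
split; first by move=> e; exact: L2_interval_horner.
apply: (esum_lty_cofinite (h := fun=> 0%E) Tfin) => //.
- by move=> e; rewrite L2_sqnorm_ge0 L2_sqnorm_lty.
- move=> e Te; rewrite edge_poly_linear// derivD derivC derivZ derivX add0r derivZ.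
  rewrite derivC scaler0 /L2_sqnorm integral0_eq// => t _.
  by rewrite hornerC expr0n.
- by rewrite esum1// ltry.
Qed.

(** The vertex values alone bound the squared norm of any candidate derivative from below by the
    energy of [U] on each finite edge set. *)
Lemma interpolant_not_H1 : ~ H1_graph interpolant.
Proof.
move=> [_ _ [f' [f'H [_ f'fin]]]].
have f'0 : (0 <= \esum_(e in [set: edge G]) L2_sqnorm (len e) (f' e))%E.
  by apply: esum_ge0 => e _; exact: L2_sqnorm_ge0.
have [F] := Uinf (fine (\esum_(e in [set: edge G]) L2_sqnorm (len e) (f' e))).
apply/negP; rewrite -leNgt -lee_fin fineK ?ge0_fin_numE//.
apply: esum_ge; exists [set` F]; first by split=> //; exact: finite_fset.
rewrite fsbig_finite; last exact: finite_fset.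
rewrite set_fsetK /energy -sumEFin; apply: lee_sum => e _.
have := H1_deriv_increment (len_gt0 e) (f'H e).
by rewrite /component chart0 chart_len.
Qed.
End Interpolant.

(** * From an end of finite volume to the required function *)

Theorem proposition4p9 (R : realType) (G : metric_graph R)
  (gamma : set (nat -> set (carrier G))) (omega : set (nat -> vertex G))
  (gamma_omega : corresponds gamma omega)
  (gamma_fin : finite_volume gamma)
  (omega_not_free : ~ free_end omega) :
  exists f : carrier G -> R, dom_H f /\ ~ H1_graph f.
Proof.
have [gammaE omegaE gamma_rays] := gamma_omega.
have [W gammaW [n Wn]] := gamma_fin.
have [Wn0 _ _] : is_end_seq W by case: gammaE gammaW => ? _ -> [].
have [_ oW _ cW] := Wn0 n.
have [X Xfin XW] := compact_boundary_edges oW cW.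
have [r omega_r rW] := gamma_rays W gammaW n.
have ray s : omega s -> is_ray s by case: omegaE => ? _ -> [].
have [N rX] := ray_eventually_off (ray _ omega_r) Xfin.
have Dfin := finite_volume_component Wn (rW N) XW.
(* Rays of the same end are inseparable, so each has a tail in the component of [r N] off [X]. *)
have tails s : omega s -> exists M, forall m, (M <= m)%N ->
    same_component_off X (r N) (s m).
  move=> omega_s.
  have insep : inseparable r s.
    apply: contrapT => /existsNP[Y /not_implyP[Yfin /existsNP[K sep]]].
    case: omegaE omega_r omega_s => r0 rr0 -> [rr rr0r] [rs rr0s].
    apply: sep; apply: (inseparable_trans rr0) => //.
      by apply: inseparable_sym; exact: ray_equiv_inseparable.
    exact: ray_equiv_inseparable.
  have [M sX] := ray_eventually_off (ray _ omega_s) Xfin.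
  have [i [j [Ni Mj rsij]]] := insep X Xfin (maxn N M).
  exists M => m Mm.
  apply: (same_component_off_trans (ray_tail_connected (ray _ omega_r) rX (leqnn N) _)).
    exact: leq_trans (leq_maxl N M) Ni.
  apply: (same_component_off_trans rsij).
  apply: (ray_tail_connected (ray _ omega_s) sX) => //.
  exact: leq_trans (leq_maxr N M) Mj.
have [U [U1 UD Uh] Uinf] := infinite_energy
  (ends_unbounded_energy Xfin Dfin omegaE omega_not_free tails).
(* A vertex outside both [X] and the component has no neighbour in the component, so [U] vanishes at
   it and at all its neighbours. *)
have UX v : ~ X v -> laplacian U v = 0.
  move=> Xv; have [Dv|Dv] := pselect (same_component_off X (r N) v); first exact: Uh.
  rewrite /laplacian big_seq big1// => e ev.
  rewrite !UD ?subrr ?mul0r// => Do; apply: Dv.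
  apply: (same_component_off_trans Do).
  apply: same_component_off_adj => //; first exact: same_component_offr Do.
  move: ev; rewrite in_incident_fset => ev; apply/asboolP; exists e.
  rewrite /other; have [->|vs] := eqVneq v (src e); first by right.
  by move: ev; rewrite eq_sym (negbTE vs) => /eqP<-; left.
exists (interpolant U); split; first exact: (interpolant_dom_H U1 UD Dfin Xfin UX).
exact: interpolant_not_H1.
Qed.
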